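(* The minimizer $\mu_R$ of $I$ over $\mathcal{M}_1(\mathbb{R}_-)$ has density with respect to Lebesgue measure on $\mathbb{R}_-$ equal to $$\phi(x)=\frac{1}{\pi(|x|+1)\sqrt{|x|}}\mathbf{1}_{\{x<0\}}.$$
   Context: $\mathbb{R}_+=(0,\infty)$, $\mathbb{R}_-=\mathbb{R}\setminus\mathbb{R}_+=(-\infty,0]$. $\mathcal{M}_1(X)$ is the space of Borel probability measures on $X$ with the weak topology; $\mathcal{M}_1(\mathbb{R}_-)$ is viewed as a subset of $\mathcal{M}_1(\mathbb{C})$. Let $\mathrm{pol}_+$ be the collection of (nonconstant) polynomials over $\mathbb{C}$ all of whose coefficients are real and positive; for $p\in\mathrm{pol}_+$ let $\mu_p$ be the empirical measure of its zeros (with multiplicity), and $\mathcal{P}=\overline{\{\mu_p:p\in\mathrm{pol}_+\}}\subset\mathcal{M}_1(\mathbb{C})$. Define $$I(\mu)=\int\log|1-z|\,d\mu(z)-\frac12\iint\log|z-w|\,d\mu(z)\,d\mu(w)\ \text{ if }\mu\in\mathcal{P},\qquad I(\mu)=\infty\ \text{ if }\mu\notin\mathcal{P},$$ where for $\mu\in\mathcal{P}$ the expression is understood as $\frac12\iint f\,d\mu\,d\mu$ with $f(z,w)=\log|1-z|+\log|1-w|-\log|z-w|$ (measures in $\mathcal{P}$ do not charge $(0,\infty)$). $\mu_R\in\mathcal{M}_1(\mathbb{R}_-)$ is defined by $I(\mu_R)=\inf_{\mu\in\mathcal{M}_1(\mathbb{R}_-)}I(\mu)$ (the minimizer exists and is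 unique). *)

(* Defs.v *)
From HB Require Import structures.
From mathcomp Require Import all_boot all_order all_algebra.
From mathcomp Require Import all_classical all_reals all_analysis.
From mathcomp Require Import complex.

Set Implicit Arguments.
Unset Strict Implicit.
Unset Printing Implicit Defensive.

Import Order.TTheory GRing.Theory Num.Theory.
Import numFieldNormedType.Exports.

Local Open Scope classical_set_scope.
Local Open Scope ring_scope.
Local Open Scope complex_scope.

(* The usual topology of R[i]: the one of the numFieldType R[i], whose balls
   are those of the modulus. *)
HB.instance Definition _ (R : rcfType) := NormedModule.copy R[i] R[i]^o.

Notation borelC R := (g_sigma_algebraType (@open (complex R))).

Notation M1 R := (probability (borelC R) R).

Definition bounded_continuous (R : realType) : set (R[i] -> R) :=
  [set f | continuous f /\ bounded_fun f].

Definition test_integrals (R : realType) (mu : M1 R) :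
    {ptws @bounded_continuous R -> R} :=
  fun f => \int[mu]_z (\val f) z.

(* The weak topology: the coarsest one making mu |-> \int f dmu continuous for
   every bounded continuous f : C -> R. *)
Notation weakM1 R := (initial_topology (@test_integrals R)).

(* In the order of R[i], 0 < z means that z is real and positive. *)
Definition pol_plus (R : realType) : set {poly R[i]} :=
  [set p | (1 < size p)%N /\ forall i, (i < size p)%N -> 0 < p`_i].

(* p = lead_coef p *: \prod_(z <- zeros p) ('X - z%:P) *)
Definition zeros (R : realType) (p : {poly R[i]}) : seq R[i] :=
  sval (closed_field_poly_normal p).

Definition empirical (R : realType) (p : {poly R[i]}) (A : set (borelC R)) :
    \bar R :=
  (((size (zeros p))%:R^-1)%:E * \sum_(z <- zeros p) \d_(z : borelC R) A)%E.

(* The value of a measure on a non-measurable set carries no information, hence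
   the comparison on Borel sets only. *)
Definition empirical_measures (R : realType) : set (weakM1 R) :=
  [set mu : M1 R | exists2 p, pol_plus p &
    forall A, measurable A -> mu A = empirical p A].

Definition calP (R : realType) : set (weakM1 R) :=
  closure (@empirical_measures R).

(* lne 0 = -oo, so the kernel is +oo on the diagonal away from 1, and -oo where
   exactly one variable is 1 (or, as +oo - oo = -oo here, both are). The measures
   of calP do not charge 1, so the values at 1 are irrelevant. *)
Definition logmod (R : realType) (z : R[i]) : \bar R :=
  lne (Normc.normc z)%:E.

Definition log_kernel (R : realType) (z w : R[i]) : \bar R :=
  (logmod (1 - z)%R + logmod (1 - w)%R - logmod (z - w)%R)%E.

Definition rate (R : realType) (mu : M1 R) : \bar R :=
  if mu \in @calP R
  then ((2^-1)%:E * \int[mu \x mu]_zw log_kernel zw.1 zw.2)%E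
  else +oo%E.

(* Subsets of the real line are embedded in C by x |-> x%:C. *)
Definition embedC (R : realType) (A : set R) : set (borelC R) :=
  [set x%:C | x in A].

Definition Rminus (R : realType) : set R := [set x | x <= 0].

Definition M1_Rminus (R : realType) : set (M1 R) :=
  [set mu | mu (embedC (@Rminus R)) = 1%E].

Definition is_minimizer (R : realType) (mu : M1 R) : Prop :=
  M1_Rminus mu /\ rate mu = ereal_inf [set rate nu | nu in @M1_Rminus R].

Definition phi (R : realType) (x : R) : R :=
  (pi * (`|x| + 1) * Num.sqrt `|x|)^-1 * \1_[set y : R | y < 0] x.

(* Main.v *)
From HB Require Import structures.
Require Import Defs.
From mathcomp Require Import all_boot all_order all_algebra.
From mathcomp Require Import all_classical all_reals all_analysis.
From mathcomp Require Import measurable_realfun random_variable.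
From mathcomp Require Import uniform_distribution ring lra.

(** The substitution [x = - tan^2 (theta / 2)] maps the angles of [[0, pi)] onto
    the negative half-line. It sends the density [phi] to the uniform density
    on [[0, pi]], and the energy kernel to the logarithmic kernel of the
    segment [[-1, 1]] at [cos theta] (lemma [log_kernel_real]):
    [[
      log |1 - x| + log |1 - y| - log |x - y| = log 2 - log |cos a - cos b|
        = 2 log 2 + 2 \sum_(n >= 1) cos (n a) cos (n b) / n.
    ]]
    Integrated against [mu] in both variables, the kernel gives twice the rate,
    called the energy below, which becomes
    [2 log 2 + 2 \sum_n c_n^2 / n], where [c_n] is the integral of
    [cos (n theta)]. The energy is therefore at least [2 log 2], with equality
    exactly when all the [c_n] with [n >= 1] vanish, that is, when [theta] is
    uniform.

    The expansion does not converge absolutely, so it is used through its Abel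
    regularisation [reg_kernel]: for a radius [r < 1] the terms are multiplied
    by [r^n], and the kernel has a closed form. It stays below the true kernel
    up to [- log r] (lemma [reg_kernel_le]), which gives
    [2 log 2 + 2 c_m^2 / m] as a lower bound of the energy
    ([angle_energy_ge]); it converges to the true kernel, which by Fatou's
    lemma gives the upper bound [2 log 2] when the moments vanish
    ([angle_energy_le]).

    The uniform angle is an admissible competitor only if its law belongs to
    the closure of the empirical measures. Let [root_of t] be the point at
    angle [pi t]. The polynomials whose zeros are the values of [root_of] at the
    midpoints of a regular subdivision of [[0, 1]] have positive coefficients,
    their zeros being negative, and the integrals of a test function against
    their empirical measures are Riemann sums ([extremal_law_calP]).

    Hence the minimizer has vanishing cosine moments ([cos_moment_minimizer]).
    The moments of [cos^2 (theta / 2) = 1 / (1 - x)] then agree with those of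
    the uniform angle, and the polynomials [(1 - u^n)^m], which approximate
    indicators of intervals, give the mass of every ray [x < b]
    ([cos_moments_determine_rays]). These masses are those of the density [phi],
    whose primitive is explicit. *)

Set Implicit Arguments.
Unset Strict Implicit.
Unset Printing Implicit Defensive.
Import Order.TTheory GRing.Theory Num.Theory.
Import numFieldNormedType.Exports.
From mathcomp Require Import complex.
Local Open Scope classical_set_scope.
Local Open Scope ring_scope.

(** * The logarithmic kernel in angular variables *)

Section LogSeries.
Variable R : realType.
Implicit Types r t a b : R.

Lemma is_derive_expr n r : is_derive r 1 (fun s : R => s ^+ n) (n%:R * r ^+ n.-1).
Proof.
apply: DeriveDef; first exact: exprn_derivable.
by rewrite exp_derive /GRing.scale/= mulr1.
Qed.

(** The squared modulus of [1 - r e^{it}]; it is the denominator of the Poisson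
    kernel, whence the name. *)
Definition poisson_den r t : R := 1 - 2 * r * cos t + r ^+ 2.

Lemma poisson_den_ge r t : 0 <= r -> (1 - r) ^+ 2 <= poisson_den r t.
Proof.
move=> r0; have := cos_le1 t; rewrite /poisson_den => c1.
have : 0 <= r * (1 - cos t) by rewrite mulr_ge0// subr_ge0.
nra.
Qed.

Lemma poisson_den_gt0 r t : 0 <= r -> r < 1 -> 0 < poisson_den r t.
Proof.
move=> r0 r1; apply: lt_le_trans (poisson_den_ge t r0).
by rewrite exprn_gt0// subr_gt0.
Qed.

Lemma cosS_recurrence t n :
  cos (n.+2%:R * t) = 2 * cos t * cos (n.+1%:R * t) - cos (n%:R * t).
Proof.
have -> : n.+2%:R * t = n.+1%:R * t + t by rewrite -(addn1 n.+1) natrD; ring.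
have -> : n%:R * t = n.+1%:R * t - t by rewrite -(addn1 n) natrD; ring.
rewrite cosB cosD; ring.
Qed.

(** The partial sums of the Fourier series
    [- 1/2 log |1 - r e^{it}|^2 = \sum_(n >= 1) r^n cos (n t) / n]. *)
Definition trig_sum N r t : R :=
  \sum_(n < N) r ^+ n.+1 / n.+1%:R * cos (n.+1%:R * t).

Definition trig_sum_deriv N r t : R := \sum_(n < N) r ^+ n * cos (n.+1%:R * t).

(** The geometric sum of the [r^n e^{i (n + 1) t}], in real form: the terms
    telescope because of [cosS_recurrence]. *)
Lemma trig_sum_derivE N r t : poisson_den r t * trig_sum_deriv N r t =
  cos t - r - r ^+ N * cos (N.+1%:R * t) + r ^+ N.+1 * cos (N%:R * t).
Proof.
rewrite /trig_sum_deriv; elim: N => [|N IH].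
  by rewrite big_ord0 mulr0 !mul1r mul0r cos0 expr1; ring.
rewrite big_ord_recr/= mulrDr IH cosS_recurrence /poisson_den !exprS; ring.
Qed.

Lemma is_derive_trig_sum N r t :
  is_derive r 1 (fun s => trig_sum N s t) (trig_sum_deriv N r t).
Proof.
rewrite /trig_sum /trig_sum_deriv.
have -> : (fun s => \sum_(n < N) s ^+ n.+1 / n.+1%:R * cos (n.+1%:R * t)) =
   \sum_(n < N) (fun s => s ^+ n.+1 / n.+1%:R * cos (n.+1%:R * t)).
  by apply/funext => s; rewrite fct_sumE.
apply: is_derive_sum => n.
have -> : (fun s : R => s ^+ n.+1 / n.+1%:R * cos (n.+1%:R * t)) =
  (n.+1%:R^-1 * cos (n.+1%:R * t)) *: (fun s : R => s ^+ n.+1).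
  by apply/funext => s; do 2 rewrite /GRing.scale/=; ring.
have hX := @is_derive_expr n.+1 r.
have := is_deriveZ (n.+1%:R^-1 * cos (n.+1%:R * t)) hX.
move=> hZ; apply: is_derive_eq; rewrite /GRing.scale/= mulrCA 2!mulrA.
by rewrite mulfV ?mul1r ?pnatr_eq0// mulrC.
Qed.

Lemma is_derive_log_den r t : 0 <= r -> r < 1 ->
  is_derive r 1 (fun s => - (2^-1) * ln (poisson_den s t))
    ((cos t - r) / poisson_den r t).
Proof.
move=> r0 r1; have d0 := poisson_den_gt0 t r0 r1.
have dd : is_derive r 1 (fun s => poisson_den s t) (2 * r - 2 * cos t).
  rewrite /poisson_den.
  have h1 := is_deriveZ (- 2 * cos t) (is_derive_id r (1 : R)).
  have h2 := is_deriveD (is_deriveD (is_derive_cst (1 : R) r (1 : R)) h1)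
    (is_derive_expr 2 r).
  have -> : (fun s => poisson_den s t) =
     cst 1 + (- 2 * cos t) *: id + (fun s => s ^+ 2).
    by apply/funext => s; rewrite /poisson_den !fctE/GRing.scale/=; ring.
  by apply: is_derive_eq; rewrite /GRing.scale/=; ring.
have dl := is_derive1_ln d0.
have := @is_derive1_comp R (@ln R) (fun s => poisson_den s t) r _ _ dl dd.
move=> h.
have -> : (fun s => - 2^-1 * ln (poisson_den s t)) =
  (- 2^-1) *: (@ln R \o (fun s => poisson_den s t)) by [].
have := is_deriveZ (- 2^-1) h.
by move=> hZ; apply: is_derive_eq; rewrite /GRing.scale/=; field; rewrite gt_eqF.
Qed.

(** The logarithm and the partial sum agree at [r = 0], and by [trig_sum_derivE] their derivatives
    in [r] differ by [r^N] times a bounded factor over [poisson_den]; the mean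
    value theorem then bounds the remainder, so that no series is ever
    exchanged with an integral below. *)
Lemma log_den_approx N r t : 0 <= r -> r < 1 ->
  `| - (2^-1) * ln (poisson_den r t) - trig_sum N r t | <=
    2 * r ^+ N / (1 - r) ^+ 2.
Proof.
move=> r0 r1.
pose f s : R := - (2^-1) * ln (poisson_den s t) - trig_sum N s t.
pose f' s : R := (cos t - s) / poisson_den s t - trig_sum_deriv N s t.
have df (s : R) : 0 <= s -> s < 1 -> is_derive s 1 f (f' s).
  move=> s0 s1.
  have h1 := is_derive_log_den t s0 s1.
  have h2 := is_derive_trig_sum N s t.
  exact: is_deriveB.
have f'E (s : R) : 0 <= s -> s < 1 -> f' s =
    s ^+ N * (cos (N.+1%:R * t) - s * cos (N%:R * t)) / poisson_den s t.
  move=> s0 s1; have d0 := poisson_den_gt0 t s0 s1.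
  have := trig_sum_derivE N s t; rewrite /f' exprS => h.
  have dn := lt0r_neq0 d0.
  have -> : trig_sum_deriv N s t =
      poisson_den s t * trig_sum_deriv N s t / poisson_den s t.
    by rewrite mulrAC mulfV// mul1r.
  by rewrite h -mulrBl; congr (_ / _); ring.
have f0 : f 0 = 0.
  rewrite /f /poisson_den /trig_sum big1 => [|i _]; last first.
    by rewrite expr0n/= !mul0r.
  by rewrite !(mulr0, mul0r, subr0, expr0n, addr0)/= ln1 mulr0.
have [->|rn0] := eqVneq r 0.
  rewrite -/(f 0) f0 normr0 divr_ge0 ?sqr_ge0// mulr_ge0// exprn_ge0//.
have rp : 0 < r by rewrite lt_neqAle eq_sym rn0.
have [||c] := @MVT R f f' 0 r rp.
- move=> x; rewrite in_itv/= => /andP[x0 xr].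
  by apply: df; [exact: ltW|exact: lt_trans r1].
- apply: derivable_within_continuous => x; rewrite in_itv/= => /andP[x0 xr].
  have := df x x0 (le_lt_trans xr r1) => h; exact: ex_derive.
rewrite in_itv/= => /andP[c0 cr]; rewrite f0 !subr0 => fr.
rewrite -/(f r) fr f'E ?(ltW c0) ?(lt_trans cr)//.
have c1 : c < 1 by apply: lt_trans cr r1.
have d0 := poisson_den_gt0 t (ltW c0) c1.
rewrite normrM (ger0_norm r0) normrM normfV (gtr0_norm d0) normrM.
rewrite (ger0_norm (exprn_ge0 _ (ltW c0))).
have h1 : `|cos (N.+1%:R * t) - c * cos (N%:R * t)| <= 2.
  apply: le_trans (ler_normB _ _) _; rewrite normrM (gtr0_norm c0).
  have := cos_max (N.+1%:R * t); have := cos_max (N%:R * t).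
  have : 0 <= `|cos (N%:R * t)| by [].
  nra.
have h2 : c ^+ N <= r ^+ N by rewrite lerXn2r// ?nnegrE ltW.
have h3 : (poisson_den c t)^-1 <= ((1 - r) ^+ 2)^-1.
  rewrite lef_pV2 ?posrE ?exprn_gt0 ?subr_gt0//.
  apply: le_trans (poisson_den_ge t (ltW c0)).
  by rewrite lerXn2r ?nnegrE ?subr_ge0 ?lerB// ltW.
rewrite -[leRHS]mulr1; apply: ler_pM => //; last exact: ltW.
  by rewrite !mulr_ge0 ?exprn_ge0 ?invr_ge0 ?(ltW d0)// ltW.
apply: ler_pM => //.
  by rewrite !mulr_ge0 ?exprn_ge0// ltW.
  by rewrite invr_ge0 ltW.
by rewrite mulrC; apply: ler_pM => //; rewrite exprn_ge0// ltW.
Qed.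

(** The Abel regularisation of [angle_kernel]. Pairing the angles [a - b] and
    [a + b] turns the cosine series into one in the products
    [cos (n a) * cos (n b)], which makes the positivity of the energy visible. *)
Definition reg_kernel r a b : R :=
  2 * ln 2 - 2^-1 * ln (poisson_den r (a - b)) - 2^-1 * ln (poisson_den r (a + b)).

Definition cos_sum N r a b : R :=
  \sum_(n < N) 2 * (r ^+ n.+1 / n.+1%:R) * (cos (n.+1%:R * a) * cos (n.+1%:R * b)).

Lemma trig_sum_cos_sum N r a b :
  trig_sum N r (a - b) + trig_sum N r (a + b) = cos_sum N r a b.
Proof.
rewrite /trig_sum /cos_sum -big_split/=; apply: eq_bigr => n _.
by rewrite mulrBr mulrDr cosB cosD; ring.
Qed.

Lemma reg_kernel_approx N r a b : 0 <= r -> r < 1 ->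
  `| reg_kernel r a b - 2 * ln 2 - cos_sum N r a b | <=
    4 * r ^+ N / (1 - r) ^+ 2.
Proof.
move=> r0 r1.
have h1 := log_den_approx N (a - b) r0 r1.
have h2 := log_den_approx N (a + b) r0 r1.
rewrite -trig_sum_cos_sum /reg_kernel.
have -> : 4 * r ^+ N / (1 - r) ^+ 2 =
  2 * r ^+ N / (1 - r) ^+ 2 + 2 * r ^+ N / (1 - r) ^+ 2 by ring.
apply: le_trans (lerD h1 h2).
apply: le_trans (ler_normD _ _).
by rewrite le_eqVlt; apply/orP; left; apply/eqP; congr `| _ |; ring.
Qed.

Lemma cvg_tail (r : R) : 0 <= r -> r < 1 ->
  4 * r ^+ N / (1 - r) ^+ 2 @[N --> \oo] --> (0 : R).
Proof.
move=> r0 r1; have -> : (0 : R) = 4 * 0 / (1 - r) ^+ 2 by rewrite mulr0 mul0r.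
by apply: cvgMr_tmp; apply: cvgMl_tmp; apply: cvg_expr; rewrite ger0_norm.
Qed.

(** With [c = cos a] and [d = cos b] the product is
    [(1 + r^2 - 2 r c d)^2 - 4 r^2 (1 - c^2) (1 - d^2)]: it depends on the
    angles through their cosines only, and tends to [4 (c - d)^2] as [r -> 1]. *)
Lemma poisson_denM r a b : poisson_den r (a - b) * poisson_den r (a + b) =
  (1 - r ^+ 2) ^+ 2 + 4 * r ^+ 2 * (cos a - cos b) ^+ 2
  - 4 * r * (1 - r) ^+ 2 * (cos a * cos b).
Proof.
rewrite /poisson_den cosB cosD.
have ha := sin2cos2 a; have hb := sin2cos2 b.
transitivity ((1 + r ^+ 2 - 2 * r * (cos a * cos b)) ^+ 2 -
  4 * r ^+ 2 * (sin a ^+ 2 * sin b ^+ 2)); first by ring.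
rewrite ha hb; ring.
Qed.

Lemma reg_kernelE r a b : 0 <= r -> r < 1 -> reg_kernel r a b = 2 * ln 2 -
  2^-1 * ln (poisson_den r (a - b) * poisson_den r (a + b)).
Proof.
move=> r0 r1; rewrite lnM ?posrE ?poisson_den_gt0//.
by rewrite mulrDr opprD addrA.
Qed.

(** This is [|1 - r e^{it}|^2 >= r |1 - e^{it}|^2] for [t = a - b] and
    [t = a + b], multiplied together. *)
Lemma poisson_denM_ge r a b : 0 <= r -> r < 1 ->
  4 * r ^+ 2 * (cos a - cos b) ^+ 2 <= poisson_den r (a - b) * poisson_den r (a + b).
Proof.
move=> r0 r1; rewrite poisson_denM.
have h : cos a * cos b <= 1.
  apply: le_trans (ler_norm _) _; rewrite normrM.
  by rewrite -[leRHS]mulr1; apply: ler_pM => //; exact: cos_max.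
have : 0 <= 4 * r * (1 - r) ^+ 2 * (1 - cos a * cos b).
  by rewrite !mulr_ge0// ?sqr_ge0// subr_ge0// ltW.
have : 0 <= ((1 - r) ^+ 2) ^+ 2 by rewrite sqr_ge0.
nra.
Qed.

Lemma poisson_den_le4 r t : 0 <= r -> r < 1 -> poisson_den r t <= 4.
Proof.
move=> r0 r1; have := cos_geN1 t; rewrite /poisson_den => c1.
have : 0 <= r * (1 + cos t) by rewrite mulr_ge0// -lerBlDl sub0r.
nra.
Qed.

Lemma ln4 : ln 4 = 2 * ln 2 :> R.
Proof.
have -> : (4 : R) = 2 ^+ 2 by ring.
by rewrite lnXn// mulr_natl.
Qed.

Lemma reg_kernel_ge0 r a b : 0 <= r -> r < 1 -> 0 <= reg_kernel r a b.
Proof.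
move=> r0 r1; rewrite /reg_kernel.
have h t : ln (poisson_den r t) <= 2 * ln 2.
  by rewrite -ln4 ler_ln ?posrE ?poisson_den_gt0 ?poisson_den_le4.
have := h (a - b); have := h (a + b); lra.
Qed.

(** The energy kernel [log |1 - x| + log |1 - y| - log |x - y|], written in the
    variables [x = - tan^2 (a / 2)] and [y = - tan^2 (b / 2)]; see
    [log_kernel_real]. *)
Definition angle_kernel a b : \bar R :=
  if cos a == cos b then +oo%E
  else (2 * ln 2 - 2^-1 * ln (4 * (cos a - cos b) ^+ 2))%:E.

(** In [poisson_denM_ge] the product loses at most a factor [r^2], hence the
    kernel gains at most [- ln r], which vanishes as [r -> 1]: this gives lower
    bounds on the energy without any integrability assumption. *)
Lemma reg_kernel_le r a b : 0 < r -> r < 1 ->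
  ((reg_kernel r a b)%:E <= angle_kernel a b + (- ln r)%:E)%E.
Proof.
move=> r0 r1; rewrite /angle_kernel; case: eqVneq => [_|cab]; first by rewrite leey.
rewrite -EFinD lee_fin reg_kernelE// ?(ltW r0)//.
have h0 : 0 < 4 * (cos a - cos b) ^+ 2.
  by rewrite mulr_gt0// lt_neqAle sqr_ge0 andbT eq_sym sqrf_eq0 subr_eq0.
have : ln (4 * r ^+ 2 * (cos a - cos b) ^+ 2) <=
    ln (poisson_den r (a - b) * poisson_den r (a + b)).
  rewrite ler_ln ?posrE ?poisson_denM_ge ?(ltW r0)//.
    by rewrite mulrAC mulr_gt0// exprn_gt0.
  by rewrite mulr_gt0// poisson_den_gt0// ltW.
rewrite [X in ln X <= _]mulrAC [X in X <= _]lnM ?posrE ?exprn_gt0// lnXn// mulr2n.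
lra.
Qed.

Definition abel_radius (n : nat) : R := 1 - n.+2%:R^-1.

Lemma abel_radius_gt0 n : 0 < abel_radius n.
Proof. by rewrite /abel_radius subr_gt0 invf_lt1// ltr1n. Qed.

Lemma abel_radius_lt1 n : abel_radius n < 1.
Proof. by rewrite /abel_radius ltrBlDr ltrDl invr_gt0. Qed.

Lemma cvg_abel_radius : abel_radius @ \oo --> (1 : R).
Proof.
rewrite -[X in _ --> X]subr0; apply: cvgB; first exact: cvg_cst.
have := @cvg_harmonic R; rewrite -(cvg_shiftn 1)/=.
by apply: cvg_trans; apply: near_eq_cvg; apply: nearW => n /=; rewrite addn1.
Qed.

Lemma cvg_reg_kernel a b :
  (reg_kernel (abel_radius n) a b)%:E @[n --> \oo] --> angle_kernel a b.
Proof.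
have rE n : reg_kernel (abel_radius n) a b = 2 * ln 2 - 2^-1 *
  ln (poisson_den (abel_radius n) (a - b) * poisson_den (abel_radius n) (a + b)).
  by rewrite reg_kernelE ?(ltW (abel_radius_gt0 _)) ?abel_radius_lt1.
pose Q n := poisson_den (abel_radius n) (a - b) * poisson_den (abel_radius n) (a + b).
have Q0 n : 0 < Q n.
  by rewrite mulr_gt0// poisson_den_gt0 ?(ltW (abel_radius_gt0 _)) ?abel_radius_lt1.
have cQ : Q n @[n --> \oo] --> 4 * (cos a - cos b) ^+ 2.
  rewrite (_ : Q = fun n => (1 - abel_radius n ^+ 2) ^+ 2 +
      4 * abel_radius n ^+ 2 * (cos a - cos b) ^+ 2 -
      4 * abel_radius n * (1 - abel_radius n) ^+ 2 * (cos a * cos b)); last first.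
    by apply/funext => n; rewrite /Q poisson_denM.
  have -> : 4 * (cos a - cos b) ^+ 2 = (1 - (1 : R) * 1) * (1 - (1 : R) * 1) +
      4 * ((1 : R) * 1) * (cos a - cos b) ^+ 2 -
      4 * (1 : R) * ((1 - 1) * (1 - 1)) * (cos a * cos b) by ring.
  have c1 := cvg_abel_radius.
  have c2 : abel_radius n ^+ 2 @[n --> \oo] --> (1 * 1 : R) by exact: cvgM.
  apply: cvgB; last first.
    apply: cvgMr_tmp; apply: cvgM; first exact: cvgMl_tmp.
    by apply: cvgM; apply: cvgB => //; exact: cvg_cst.
  apply: cvgD; first by apply: cvgM; apply: cvgB => //; exact: cvg_cst.
  by apply: cvgMr_tmp; exact: cvgMl_tmp.
rewrite /angle_kernel; under eq_cvg do rewrite rE -/(Q _).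
case: eqVneq => [cab|cab]; last first.
  apply: cvg_EFin; first exact: nearW.
  apply: cvgB; first exact: cvg_cst.
  apply: cvgMl_tmp; apply: continuous_cvg => //.
  apply: continuous_ln.
  by rewrite mulr_gt0// lt_neqAle sqr_ge0 andbT eq_sym sqrf_eq0 subr_eq0.
apply/cvgeyPge => M.
(* On the diagonal the product of the denominators tends to 0, so its
   logarithm goes below any prescribed level. *)
have QM : \forall n \near \oo, Q n < expR (2 * (2 * ln 2 - M)).
  move: cQ; rewrite cab subrr expr0n mulr0 => cQ.
  by apply: (cvgr_lt 0 cQ); exact: expR_gt0.
near=> n; rewrite lee_fin.
have : ln (Q n) <= 2 * (2 * ln 2 - M).
  rewrite -[leRHS]expRK ler_ln ?posrE ?expR_gt0// ltW//; near: n; exact: QM.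
lra.
Unshelve. all: by end_near. Qed.

End LogSeries.

(** * The energy of a law of angles *)

Section BoundedIntegrals.
Context d (T : measurableType d) (R : realType) (P : probability T R).

Lemma bounded_integrable (f : T -> R) (M : R) : measurable_fun setT f ->
  (forall x, `|f x| <= M) -> P.-integrable setT (EFin \o f).
Proof.
move=> mf fM; apply: measurable_bounded_integrable => //.
  by rewrite (le_lt_trans (probability_le1 P measurableT))// ltry.
exists M; split; first exact: num_real.
by move=> N MN x _; apply: le_trans (fM x) (ltW MN).
Qed.

Lemma Rintegral_fin (f : T -> R) : P.-integrable setT (EFin \o f) ->
  (\int[P]_x (f x)%:E = (\int[P]_x f x)%:E)%E.
Proof. by move=> fi; rewrite /Rintegral fineK//; exact: integrable_fin_num. Qed.

Lemma integrable_prob_cst (c : R) : P.-integrable setT (EFin \o cst c).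
Proof. exact: (bounded_integrable (M := `|c|)). Qed.

Lemma Rintegral_prob_cst (c : R) : \int[P]_x c = c.
Proof.
rewrite Rintegral_cst// [X in fine X](_ : _ = 1%E) ?mulr1//.
exact: probability_setT.
Qed.

End BoundedIntegrals.

Lemma Rintegral_prod d (T : measurableType d) (R : realType)
    (P : probability T R) (f g : T -> R) (M N : R) :
  measurable_fun setT f -> measurable_fun setT g ->
  (forall x, `|f x| <= M) -> (forall x, `|g x| <= N) ->
  \int[(P \x P)%E]_z (f z.1 * g z.2) = (\int[P]_x f x) * (\int[P]_x g x).
Proof.
move=> mf mg fM gN.
have fi := bounded_integrable P mf fM; have gi := bounded_integrable P mg gN.
have mfg : measurable_fun setT (fun z : T * T => f z.1 * g z.2).
  by apply: measurable_funM; apply: measurableT_comp.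
have fgi := bounded_integrable (P \x P)%E mfg (M := M * N).
rewrite {1}/Rintegral -integral12_prod_meas1/=; last first.
  by apply: fgi => z; rewrite normrM ler_pM.
transitivity (fine (\int[P]_x (f x * \int[P]_y g y)%:E)%E).
  congr fine; apply: eq_integral => x _; rewrite /fubini_F/=.
  under eq_integral do rewrite EFinM.
  by rewrite integralZl// Rintegral_fin.
rewrite -/(Rintegral P setT (fun x => f x * \int[P]_y g y)) RintegralZr//.
Qed.

Section Energy.
Context d (T : measurableType d) (R : realType) (P : probability T R).
Variable theta : T -> R.
Hypothesis mtheta : measurable_fun setT theta.

Implicit Type r : R.

Definition cos_moment n : R := \int[P]_x cos (n%:R * theta x).

Lemma measurable_cos_theta n : measurable_fun setT (fun x => cos (n%:R * theta x)).
Proof.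
apply: measurableT_comp; last exact: measurable_funM (measurable_cst _) mtheta.
apply: continuous_measurable_fun; exact: continuous_cos.
Qed.

Lemma measurable_reg_kernel r :
  measurable_fun setT (fun z : T * T => reg_kernel r (theta z.1) (theta z.2)).
Proof.
have mc : measurable_fun setT (@cos R).
  by apply: continuous_measurable_fun; exact: continuous_cos.
have m1 : measurable_fun setT (fun z : T * T => theta z.1) by exact: measurableT_comp.
have m2 : measurable_fun setT (fun z : T * T => theta z.2) by exact: measurableT_comp.
have mden (g : T * T -> R) : measurable_fun setT g ->
    measurable_fun setT (fun z => 2^-1 * ln (poisson_den r (g z))).
  move=> mg; apply: measurable_funM => //; apply: measurableT_comp => //.
  rewrite /poisson_den; apply: measurable_funD => //; apply: measurable_funB => //.
  by apply: measurable_funM => //; apply: measurableT_comp.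
rewrite /reg_kernel; apply: measurable_funB.
  by apply: measurable_funB => //; apply: mden; exact: measurable_funB.
by apply: mden; exact: measurable_funD.
Qed.

Lemma reg_kernel_bound r : 0 <= r -> r < 1 ->
  forall z : T * T, `| reg_kernel r (theta z.1) (theta z.2) | <=
    2 * ln 2 + 4 / (1 - r) ^+ 2.
Proof.
move=> r0 r1 z.
have := reg_kernel_approx 0 (theta z.1) (theta z.2) r0 r1.
rewrite /cos_sum big_ord0 subr0 expr0 mulr1 => h.
have l2 : 0 <= ln 2 :> R by rewrite ln_ge0// ler1n.
rewrite -[X in `|X|](subrK (2 * ln 2)); apply: le_trans (ler_normD _ _) _.
by rewrite addrC lerD// ger0_norm// mulr_ge0.
Qed.

Lemma integrable_reg_kernel r : 0 <= r -> r < 1 ->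
  (P \x P)%E.-integrable setT (EFin \o (fun z => reg_kernel r (theta z.1) (theta z.2))).
Proof.
move=> r0 r1; apply: (@bounded_integrable _ _ _ (P \x P)%E).
  exact: measurable_reg_kernel.
exact: reg_kernel_bound.
Qed.

Definition reg_energy r : R :=
  \int[(P \x P)%E]_z (reg_kernel r (theta z.1) (theta z.2)).

(** The integral of [cos_sum] against the product measure: a sum of squares,
    by Fubini. *)
Definition moment_sum N r : R :=
  \sum_(n < N) 2 * (r ^+ n.+1 / n.+1%:R) * cos_moment n.+1 ^+ 2.

Let measurable_coscos n : measurable_fun setT
  (fun z : T * T => cos (n%:R * theta z.1) * cos (n%:R * theta z.2)).
Proof.
apply: measurable_funM.
  exact: (measurableT_comp (measurable_cos_theta n) measurable_fst).
exact: (measurableT_comp (measurable_cos_theta n) measurable_snd).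
Qed.

Let coscos_bound n (z : T * T) :
  `|cos (n%:R * theta z.1) * cos (n%:R * theta z.2)| <= 1.
Proof.
by rewrite normrM -[leRHS]mulr1 ler_pM// cos_max.
Qed.

Let integrable_coscos (c : R) n : (P \x P)%E.-integrable setT
  (EFin \o (fun z : T * T => c * (cos (n%:R * theta z.1) * cos (n%:R * theta z.2)))).
Proof.
apply: (@bounded_integrable _ _ _ (P \x P)%E _ (`|c|)).
  by apply: measurable_funM => //.
by move=> z; rewrite normrM -[leRHS]mulr1 ler_pM.
Qed.

Lemma integrable_cos_sum N r : (P \x P)%E.-integrable setT
  (EFin \o (fun z : T * T => cos_sum N r (theta z.1) (theta z.2))).
Proof.
pose h n (z : T * T) : R := (2 * (r ^+ n.+1 / n.+1%:R)) *
  (cos (n.+1%:R * theta z.1) * cos (n.+1%:R * theta z.2)).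
rewrite (_ : _ \o _ = fun z => (\sum_(n < N) (EFin \o h n) z)%E).
  by apply: integrable_sum => // n _; exact: integrable_coscos.
by apply/funext => z /=; rewrite /cos_sum sumEFin.
Qed.

Lemma integral_cos_sum N r :
  \int[(P \x P)%E]_z (cos_sum N r (theta z.1) (theta z.2)) = moment_sum N r.
Proof.
elim: N => [|N IH].
  rewrite /moment_sum big_ord0 /cos_sum.
  under eq_Rintegral do rewrite big_ord0.
  by rewrite (@Rintegral_prob_cst _ _ _ (P \x P)%E).
rewrite /moment_sum big_ord_recr/= -/(moment_sum N r) -IH.
transitivity (\int[(P \x P)%E]_z (cos_sum N r (theta z.1) (theta z.2) +
  2 * (r ^+ N.+1 / N.+1%:R) * (cos (N.+1%:R * theta z.1) * cos (N.+1%:R * theta z.2)))).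
  by apply: eq_Rintegral => z _; rewrite /cos_sum big_ord_recr.
rewrite RintegralD//; last exact: integrable_cos_sum.
congr (_ + _); rewrite RintegralZl//; last first.
  by have := integrable_coscos 1 N.+1; apply: eq_integrable => // z _ /=; rewrite mul1r.
rewrite (@Rintegral_prod _ _ _ P (fun x => cos (N.+1%:R * theta x))
  (fun x => cos (N.+1%:R * theta x)) 1 1) ?expr2//; try exact: measurable_cos_theta.
all: by move=> x; exact: cos_max.
Qed.

Lemma reg_energy_approx N r : 0 <= r -> r < 1 ->
  `| reg_energy r - (2 * ln 2 + moment_sum N r) | <= 4 * r ^+ N / (1 - r) ^+ 2.
Proof.
move=> r0 r1.
have ir := integrable_reg_kernel r0 r1; have ic := integrable_cos_sum N r.
have ik : (P \x P)%E.-integrable setT (EFin \o cst (2 * ln 2 : R)).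
  exact: (@integrable_prob_cst _ _ _ (P \x P)%E).
have -> : 2 * ln 2 + moment_sum N r =
   \int[(P \x P)%E]_z (2 * ln 2 + cos_sum N r (theta z.1) (theta z.2)).
  by rewrite RintegralD// integral_cos_sum (@Rintegral_prob_cst _ _ _ (P \x P)%E).
have iS : (P \x P)%E.-integrable setT
    (EFin \o (fun z => 2 * ln 2 + cos_sum N r (theta z.1) (theta z.2))).
  by have := integrableD measurableT ik ic; apply: eq_integrable.
have ib : (P \x P)%E.-integrable setT
    (EFin \o (fun z => reg_kernel r (theta z.1) (theta z.2) -
      (2 * ln 2 + cos_sum N r (theta z.1) (theta z.2)))).
  by have := integrableB measurableT ir iS; apply: eq_integrable.
rewrite /reg_energy -RintegralB//.
apply: le_trans (le_normr_Rintegral measurableT ib) _.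
rewrite -[leRHS](@Rintegral_prob_cst _ _ _ (P \x P)%E).
apply: le_Rintegral => //.
- exact: integrable_norm.
- exact: (@integrable_prob_cst _ _ _ (P \x P)%E).
- by move=> z _; rewrite opprD addrA; exact: reg_kernel_approx.
Qed.

Definition angle_energy : \bar R :=
  (\int[P \x P]_z angle_kernel (theta z.1) (theta z.2))%E.

(** A pointwise limit of regularised kernels, which are continuous
    functions of the angles. *)
Lemma measurable_angle_kernel :
  measurable_fun setT (fun z : T * T => angle_kernel (theta z.1) (theta z.2)).
Proof.
apply: (emeasurable_fun_cvg (fun (n : nat) (z : T * T) =>
    (reg_kernel (abel_radius R n) (theta z.1) (theta z.2))%:E)) => [n|z _].
  apply/measurable_EFinP; exact: measurable_reg_kernel.
exact: cvg_reg_kernel.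
Qed.

Lemma angle_kernel_ge0 (a b : R) : (0 <= angle_kernel a b)%E.
Proof.
apply: (cvge_to_ge (@cvg_reg_kernel R a b)); apply: nearW => n.
by rewrite lee_fin reg_kernel_ge0 ?abel_radius_lt1// ltW// abel_radius_gt0.
Qed.

Lemma reg_energy_ge m r : 0 <= r -> r < 1 ->
  2 * ln 2 + 2 * (r ^+ m.+1 / m.+1%:R) * cos_moment m.+1 ^+ 2 <= reg_energy r.
Proof.
move=> r0 r1.
have c1 : reg_energy r + 4 * r ^+ N / (1 - r) ^+ 2 @[N --> \oo] --> reg_energy r.
  by rewrite -[X in _ --> X]addr0; apply: cvgD; [exact: cvg_cst|exact: cvg_tail].
apply: (ler_cvg_to (cvg_cst _) c1); near=> N.
have mN : (m < N)%N by near: N; exact: nbhs_infty_gt.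
have := reg_energy_approx N r0 r1; rewrite ler_norml => /andP[+ _].
have : 2 * (r ^+ m.+1 / m.+1%:R) * cos_moment m.+1 ^+ 2 <= moment_sum N r.
  rewrite /moment_sum (bigD1 (Ordinal mN))//= lerDl sumr_ge0// => i _.
  by rewrite mulr_ge0 ?sqr_ge0// mulr_ge0// divr_ge0// exprn_ge0.
set a := 2 * (_ / _) * _; set B := 4 * _ / _; set c := moment_sum N r; lra.
Unshelve. all: by end_near. Qed.

(** Every squared cosine moment costs energy. Compare with the regularised
    kernel by [reg_kernel_le], keep one term of its nonnegative expansion, and
    let the radius tend to 1. *)
Lemma angle_energy_ge m :
  ((2 * ln 2 + 2 / m.+1%:R * cos_moment m.+1 ^+ 2)%:E <= angle_energy)%E.
Proof.
have h n : ((2 * ln 2 + 2 * (abel_radius R n ^+ m.+1 / m.+1%:R) * cos_moment m.+1 ^+ 2)%:E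
    <= angle_energy + (- ln (abel_radius R n))%:E)%E.
  have r0 := abel_radius_gt0 R n; have r1 := abel_radius_lt1 R n.
  apply: (@le_trans _ _ (reg_energy (abel_radius R n))%:E).
    by rewrite lee_fin; apply: reg_energy_ge => //; exact: ltW.
  rewrite -(@Rintegral_fin _ _ _ (P \x P)%E); last first.
    exact: integrable_reg_kernel (ltW r0) r1.
  have l0 : 0 <= - ln (abel_radius R n) by rewrite oppr_ge0 ln_le0// ltW.
  have -> : (angle_energy + (- ln (abel_radius R n))%:E = \int[P \x P]_z
     (angle_kernel (theta z.1) (theta z.2) + (- ln (abel_radius R n))%:E))%E.
    rewrite ge0_integralD//=.
    - rewrite integral_cst// (_ : (_ [set: _])%E = 1%E) ?mule1//.
      exact: (@probability_setT _ _ _ (P \x P)%E).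
    - by move=> z _; exact: angle_kernel_ge0.
    - exact: measurable_angle_kernel.
  apply: ge0_le_integral => //=.
  - by move=> z _; rewrite lee_fin reg_kernel_ge0// ltW.
  - by apply/measurable_EFinP; exact: measurable_reg_kernel.
  - by apply: emeasurable_funD => //; exact: measurable_angle_kernel.
  - by move=> z _; exact: reg_kernel_le.
case E : angle_energy h => [e| |] h; [|by rewrite leey|]; last first.
  by have := h 0%N; rewrite leNgt ltNye.
rewrite lee_fin.
have cr := @cvg_abel_radius R.
have c1 : 2 * ln 2 + 2 * (abel_radius R n ^+ m.+1 / m.+1%:R) * cos_moment m.+1 ^+ 2
    @[n --> \oo] --> 2 * ln 2 + 2 / m.+1%:R * cos_moment m.+1 ^+ 2.
  apply: cvgD; first exact: cvg_cst.
  apply: cvgMr_tmp; apply: cvgMl_tmp.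
  rewrite -[X in _ --> X]mul1r; apply: cvgMr_tmp.
  rewrite -(expr1n R m.+1).
  apply: (@cvg_comp _ _ _ _ (fun x : R => x ^+ m.+1) _ _ _ cr).
  exact: exprn_continuous.
have c2 : e - ln (abel_radius R n) @[n --> \oo] --> e.
  rewrite -[X in _ --> X]subr0 -ln1; apply: cvgB; first exact: cvg_cst.
  apply: continuous_cvg => //; exact: continuous_ln.
apply: (ler_cvg_to c1 c2); apply: nearW => n.
by have := h n; rewrite -EFinD lee_fin.
Qed.

(** When the cosine moments vanish, the regularised energies all equal
    [2 ln 2], and Fatou's lemma passes this upper bound to the limit kernel. *)
Lemma angle_energy_le : (forall m, cos_moment m.+1 = 0) ->
  (angle_energy <= (2 * ln 2)%:E)%E.
Proof.
move=> c0.
have rE n : reg_energy (abel_radius R n) = 2 * ln 2.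
  have r0 := ltW (abel_radius_gt0 R n); have r1 := abel_radius_lt1 R n.
  apply/eqP; rewrite -subr_eq0 -normr_le0.
  apply: (ler_cvg_to (cvg_cst _) (cvg_tail r0 r1)); apply: nearW => N.
  have := reg_energy_approx N r0 r1.
  by rewrite /moment_sum big1 ?addr0// => i _; rewrite c0 expr0n mulr0.
have -> : angle_energy = (\int[P \x P]_z limn_einf
    (fun n => (reg_kernel (abel_radius R n) (theta z.1) (theta z.2))%:E))%E.
  apply: eq_integral => z _; have := @cvg_reg_kernel R (theta z.1) (theta z.2).
  by move=> /cvg_limn_einf_sup[-> _].
apply: le_trans (fatou _ _ _ _) _ => //.
- by move=> n; apply/measurable_EFinP; exact: measurable_reg_kernel.
- move=> n z _.
  by rewrite lee_fin reg_kernel_ge0 ?abel_radius_lt1// ltW// abel_radius_gt0.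
have iE n : (\int[P \x P]_z
    (reg_kernel (abel_radius R n) (theta z.1) (theta z.2))%:E = (2 * ln 2)%:E)%E.
  rewrite (@Rintegral_fin _ _ _ (P \x P)%E); last first.
    apply: integrable_reg_kernel; last exact: abel_radius_lt1.
    exact: ltW (abel_radius_gt0 R n).
  by rewrite -/(reg_energy _) rE.
under eq_fun do rewrite iE.
by have [-> _] := cvg_limn_einf_sup (@cvg_cst _ (2 * ln 2 : R)%:E _ \oo _).
Qed.

End Energy.

(** * Cosine moments determine the law of the angle *)

Section StepPolynomials.
Variable R : realType.
Implicit Types x y q tau : R.

Lemma bernoulli_le x n : -1 <= x -> 1 + n%:R * x <= (1 + x) ^+ n.
Proof.
move=> x1; elim: n => [|n IH]; first by rewrite mul0r addr0 expr0.
rewrite exprS; have x0 : 0 <= 1 + x by rewrite -lerBlDl sub0r.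
apply: le_trans (ler_wpM2l x0 IH).
have : 0 <= n%:R * x ^+ 2 by rewrite mulr_ge0 ?sqr_ge0.
by rewrite -natr1; lra.
Qed.

(** Bernoulli's inequality applied to [(1 + y)^m], since
    [(1 - y)^m (1 + y)^m <= 1]. *)
Lemma expr_onem_le y m : 0 <= y -> y <= 1 -> (1 - y) ^+ m <= (1 + m%:R * y)^-1.
Proof.
move=> y0 y1; have m0 : 0 < 1 + m%:R * y by rewrite ltr_pwDl// mulr_ge0.
rewrite -[leRHS]mul1r ler_pdivlMr//.
have h0 : 0 <= (1 - y) ^+ m by rewrite exprn_ge0// subr_ge0.
have y1' : -1 <= y by apply: le_trans y0; rewrite lerN10.
apply: le_trans (ler_wpM2l h0 (bernoulli_le m y1')) _.
rewrite -exprMn (_ : (1 - y) * (1 + y) = 1 - y ^+ 2); last by ring.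
by rewrite exprn_ile1// ?subr_ge0 ?exprn_ile1// gerBl sqr_ge0.
Qed.

Lemma cvg_natM_expr q : 0 <= q -> q < 1 -> n%:R * q ^+ n @[n --> \oo] --> (0 : R).
Proof.
rewrite le_eqVlt => /predU1P[<- _|q0 q1].
  apply: cvg_near_cst; near=> n.
  have n0 : (0 < n)%N by near: n; exact: nbhs_infty_gt.
  by rewrite expr0n eqn0Ngt n0/= mulr0.
(* With q = s^2, one factor s^n absorbs n by Bernoulli's inequality, and the
   other tends to 0. *)
pose s := Num.sqrt q.
have s0 : 0 < s by rewrite sqrtr_gt0.
have sq : s ^+ 2 = q by rewrite sqr_sqrtr// ltW.
have s1 : s < 1 by rewrite -sqrtr1 ltr_sqrt.
have bd n : n%:R * s ^+ n <= (s^-1 - 1)^-1.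
  have d0 : 0 < s^-1 - 1 by rewrite subr_gt0 invf_gt1.
  rewrite -[leRHS]mul1r ler_pdivlMr// mulrAC -ler_pdivlMr ?exprn_gt0//.
  rewrite mul1r -exprVn.
  have := @bernoulli_le (s^-1 - 1) n; rewrite [1 + (_ - 1)]addrC subrK => h.
  apply: le_trans (h _); first by rewrite lerDr ler01.
  by apply: le_trans (ltW d0); rewrite lerN10.
apply: (@squeeze_cvgr _ _ _ _ (cst 0) (fun n => (s^-1 - 1)^-1 * s ^+ n)).
- apply: nearW => n; rewrite mulr_ge0 ?exprn_ge0 ?(ltW q0)//=.
  rewrite -sq -exprM mulnC muln2 -addnn exprD mulrA.
  by rewrite ler_wpM2r// exprn_ge0// ltW.
- exact: cvg_cst.
- rewrite -[X in _ --> X](mulr0 (s^-1 - 1)^-1); apply: cvgMl_tmp.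
  by apply: cvg_expr; rewrite gtr0_norm.
Unshelve. all: by end_near. Qed.

(** Of order [n / tau^n]. The factor [n] makes [step_poly tau n] tend to 0 at
    [tau] itself; with the exponent [1 / tau^n] the limit there would be [1 / e]. *)
Definition step_exponent tau n : nat := (Num.truncn (n%:R / tau ^+ n)).+1.

Definition step_poly tau n : {poly R} := (1 - 'X^n) ^+ step_exponent tau n.

Lemma horner_step_poly tau n x :
  (step_poly tau n).[x] = (1 - x ^+ n) ^+ step_exponent tau n.
Proof. by rewrite /step_poly !hornerE. Qed.

Lemma step_poly_ge0 tau n x : 0 <= x <= 1 -> 0 <= (step_poly tau n).[x].
Proof.
by move=> /andP[x0 x1]; rewrite horner_step_poly exprn_ge0// subr_ge0 exprn_ile1.
Qed.

Lemma step_poly_le1 tau n x : 0 <= x <= 1 -> (step_poly tau n).[x] <= 1.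
Proof.
move=> /andP[x0 x1]; rewrite horner_step_poly exprn_ile1//.
  by rewrite subr_ge0 exprn_ile1.
by rewrite gerBl exprn_ge0.
Qed.

(** These explicit polynomials replace the Weierstrass approximation theorem:
    [(1 - x^n)^m] is at least [1 - m x^n] and at most [1 / (1 + m x^n)], while
    [m x^n] is of order [n (x / tau)^n]. *)
Lemma cvg_step_poly tau x : 0 < tau -> tau <= 1 -> 0 <= x <= 1 ->
  (step_poly tau n).[x] @[n --> \oo] --> ((x < tau)%R%:R : R).
Proof.
move=> t0 t1 x01; have /andP[x0 x1] := x01.
have tn n : 0 < tau ^+ n by rewrite exprn_gt0.
have [xt|tx] := ltP x tau.
- pose q := x / tau.
  have q0 : 0 <= q by rewrite divr_ge0// ltW.
  have q1 : q < 1 by rewrite ltr_pdivrMr// mul1r.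
  apply: (@squeeze_cvgr _ _ _ _ (fun n => 1 - (n%:R * q ^+ n + x ^+ n)) (cst 1)).
  + apply: nearW => n; rewrite step_poly_le1// andbT horner_step_poly.
    have xn : -1 <= - x ^+ n by rewrite lerN2 exprn_ile1.
    apply: le_trans (bernoulli_le (step_exponent tau n) xn).
    rewrite mulrN lerD2l lerN2 /step_exponent -natr1 mulrDl mul1r lerD2r.
    rewrite (_ : n%:R * q ^+ n = n%:R / tau ^+ n * x ^+ n); last first.
      by rewrite /q expr_div_n mulrA mulrAC.
    by rewrite ler_wpM2r ?exprn_ge0// truncn_le divr_ge0// ltW.
  + rewrite -[X in _ --> X]subr0 -[X in _ - X]addr0; apply: cvgB; first exact: cvg_cst.
    apply: cvgD; first exact: cvg_natM_expr.
    by apply: cvg_expr; rewrite ger0_norm// (lt_le_trans xt).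
  + exact: cvg_cst.
- apply: (@squeeze_cvgr _ _ _ _ (cst 0) (fun n => (n.+1%:R)^-1)).
  + apply: nearW => n; rewrite step_poly_ge0//= horner_step_poly.
    apply: le_trans (expr_onem_le _ _ _) _.
    * by rewrite exprn_ge0.
    * by rewrite exprn_ile1.
    rewrite lef_pV2 ?posrE// ?ltr_pwDl// ?mulr_ge0 ?exprn_ge0//.
    rewrite -nat1r lerD2l.
    apply: (@le_trans _ _ (n%:R / tau ^+ n * x ^+ n)).
      by rewrite mulrAC -mulrA ler_peMr// ler_pdivlMr// mul1r lerXn2r ?nnegrE// ltW.
    by rewrite ler_wpM2r ?exprn_ge0// ltW// truncnS_gt.
  + exact: cvg_cst.
  + exact: cvg_harmonic.
Qed.

End StepPolynomials.

Section CosineMoments.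
Context d (T : measurableType d) (R : realType) (P : probability T R).
Variable theta : T -> R.
Hypothesis mtheta : measurable_fun setT theta.

(** This is [cos^2 (t / 2)], which becomes [1 / (1 - x)] when
    [x = - tan^2 (t / 2)]. *)
Definition half_cos2 (t : R) : R := (1 + cos t) / 2.

Lemma half_cos2_itv t : 0 <= half_cos2 t <= 1.
Proof.
rewrite /half_cos2; have := cos_le1 t; have := cos_geN1 t => h1 h2.
by apply/andP; split; lra.
Qed.

Lemma measurable_half_cos2 : measurable_fun setT (fun x => half_cos2 (theta x)).
Proof.
rewrite /half_cos2; apply: measurable_funM => //; apply: measurable_funD => //.
apply: measurableT_comp => //.
by apply: continuous_measurable_fun; exact: continuous_cos.
Qed.

Lemma measurable_half_cos2_lt tau :
  measurable [set x | half_cos2 (theta x) < tau].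
Proof.
rewrite (_ : [set _ | _] =
    setT `&` (fun x => half_cos2 (theta x)) @^-1` `]-oo, tau[%classic).
  by apply: measurable_half_cos2 => //; exact: measurable_itv.
by rewrite setTI; apply/seteqP; split => x /=; rewrite in_itv.
Qed.

Lemma measurable_step_poly tau n :
  measurable_fun setT (fun x => (step_poly tau n).[half_cos2 (theta x)]).
Proof.
rewrite (_ : (fun x => _) =
    (fun x => (1 - half_cos2 (theta x) ^+ n) ^+ step_exponent tau n)).
  apply: measurable_funX; apply: measurable_funB => //.
  by apply: measurable_funX; exact: measurable_half_cos2.
by apply/funext => x; rewrite horner_step_poly.
Qed.

Let mixed j n x := half_cos2 (theta x) ^+ j * cos (n%:R * theta x).

Let integrable_mixed j n : P.-integrable setT (EFin \o mixed j n).
Proof.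
apply: (@bounded_integrable _ _ _ _ _ 1).
  apply: measurable_funM; last exact: measurable_cos_theta.
  by apply: measurable_funX; exact: measurable_half_cos2.
move=> x; rewrite normrM -[leRHS]mulr1 ler_pM// ?cos_max//.
have /andP[h0 h1] := half_cos2_itv (theta x).
by rewrite ger0_norm ?exprn_ge0// exprn_ile1.
Qed.

(** Together with [integral_half_cos2_cosS], this expresses the mixed moments of
    degree [j + 1] through those of degree [j], by the product formula for
    cosines; hence the cosine moments determine all of them. *)
Lemma integral_half_cos2_cos0 j :
  \int[P]_x (half_cos2 (theta x) ^+ j.+1 * cos (0%:R * theta x)) =
  2^-1 * (\int[P]_x (half_cos2 (theta x) ^+ j * cos (0%:R * theta x))) +
  2^-1 * (\int[P]_x (half_cos2 (theta x) ^+ j * cos (1%:R * theta x))).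
Proof.
rewrite -!RintegralZl// -?RintegralD//.
- by apply: eq_Rintegral => x _; rewrite exprSr !mul1r mul0r cos0 /half_cos2; ring.
- exact: integrableZl (integrable_mixed j 0).
- exact: integrableZl (integrable_mixed j 1).
- exact: integrable_mixed j 1.
- exact: integrable_mixed j 0.
Qed.

Lemma integral_half_cos2_cosS j n :
  \int[P]_x (half_cos2 (theta x) ^+ j.+1 * cos (n.+1%:R * theta x)) =
  2^-1 * (\int[P]_x (half_cos2 (theta x) ^+ j * cos (n.+1%:R * theta x))) +
  4^-1 * (\int[P]_x (half_cos2 (theta x) ^+ j * cos (n.+2%:R * theta x))) +
  4^-1 * (\int[P]_x (half_cos2 (theta x) ^+ j * cos (n%:R * theta x))).
Proof.
have i0 := integrable_mixed j n.
have i1 := integrable_mixed j n.+1.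
have i2 := integrable_mixed j n.+2.
rewrite -!RintegralZl// -!RintegralD//.
- apply: eq_Rintegral => x _; by rewrite exprSr cosS_recurrence /half_cos2; field.
- have := integrableD measurableT (integrableZl measurableT 2^-1 i1)
    (integrableZl measurableT 4^-1 i2).
  by apply: eq_integrable.
- exact: integrableZl i0.
- exact: integrableZl i1.
- exact: integrableZl i2.
Qed.

Lemma integral_horner_half_cos2 (p : {poly R}) :
  \int[P]_x p.[half_cos2 (theta x)] =
  \sum_(i < size p) p`_i * \int[P]_x (half_cos2 (theta x) ^+ i * cos (0%:R * theta x)).
Proof.
transitivity (\int[P]_x (\sum_(i < size p) p`_i * mixed i 0 x)).
  apply: eq_Rintegral => x _; rewrite horner_coef; apply: eq_bigr => i _.
  by rewrite /mixed mul0r cos0 mulr1.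
have iz i : P.-integrable setT (EFin \o (fun x => p`_i * mixed i 0 x)).
  exact: integrableZl (integrable_mixed i 0).
elim: (size p) => [|n IH].
  under eq_Rintegral do rewrite big_ord0.
  by rewrite Rintegral_prob_cst big_ord0.
transitivity (\int[P]_x (\sum_(i < n) p`_i * mixed i 0 x + p`_n * mixed n 0 x)).
  by apply: eq_Rintegral => x _; rewrite big_ord_recr.
rewrite RintegralD//; last first.
  pose h i x := p`_i * mixed i 0 x.
  rewrite (_ : _ \o _ = fun x => (\sum_(i < n) (EFin \o h i) x)%E).
    by apply: integrable_sum => // i _; exact: iz.
  by apply/funext => x /=; rewrite sumEFin.
rewrite IH [RHS]big_ord_recr/=; congr (_ + _).
by rewrite RintegralZl//; exact: integrable_mixed.
Qed.

Lemma cvg_integral_step_poly tau : 0 < tau -> tau <= 1 ->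
  (\int[P]_x (step_poly tau n).[half_cos2 (theta x)]%:E)%E @[n --> \oo] -->
  P [set x | half_cos2 (theta x) < tau].
Proof.
move=> t0 t1.
pose A := [set x | half_cos2 (theta x) < tau].
have mA : measurable A := measurable_half_cos2_lt tau.
have -> : P A = (\int[P]_x (\1_A x)%:E)%E by rewrite integral_indic// setIT.
have [] := @dominated_convergence _ _ _ P setT measurableT
  (fun n x => (step_poly tau n).[half_cos2 (theta x)]%:E) (EFin \o \1_A)
  (cst 1%E) _ _ _ _ _ => //.
- by move=> n; apply/measurable_EFinP; exact: measurable_step_poly.
- by apply/measurable_EFinP; exact: measurable_indic.
- apply: aeW => x _ /=; apply: cvg_EFin; first exact: nearW.
  rewrite indicE (_ : (x \in A) = (half_cos2 (theta x) < tau)); last first.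
    by apply/idP/idP; rewrite inE.
  exact: cvg_step_poly (half_cos2_itv _).
- exact: integrable_prob_cst.
- apply: aeW => x n _ /=; rewrite lee_fin ger0_norm.
    exact: step_poly_le1 (half_cos2_itv _).
  exact: step_poly_ge0 (half_cos2_itv _).
Qed.

End CosineMoments.

(** The step polynomials have the same integrals for both laws, and they converge
    boundedly to the indicator of the ray. *)
Lemma cos_moments_determine_rays (R : realType)
    d (T : measurableType d) (P : probability T R) (theta : T -> R)
    d' (T' : measurableType d') (P' : probability T' R) (theta' : T' -> R) tau :
  measurable_fun setT theta -> measurable_fun setT theta' ->
  (forall n, cos_moment P theta n.+1 = cos_moment P' theta' n.+1) ->
  0 < tau -> tau <= 1 ->
  P [set x | half_cos2 (theta x) < tau] = P' [set x | half_cos2 (theta' x) < tau].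
Proof.
move=> mt mt' cc t0 t1.
have mixedE j n :
    \int[P]_x (half_cos2 (theta x) ^+ j * cos (n%:R * theta x)) =
    \int[P']_x (half_cos2 (theta' x) ^+ j * cos (n%:R * theta' x)).
  elim: j n => [|j IH] n; last first.
    case: n => [|n].
      by rewrite !integral_half_cos2_cos0// !IH.
    by rewrite !integral_half_cos2_cosS// !IH.
  under eq_Rintegral do rewrite expr0 mul1r.
  under [RHS]eq_Rintegral do rewrite expr0 mul1r.
  case: n => [|n]; last exact: cc.
  under eq_Rintegral do rewrite mul0r cos0.
  under [RHS]eq_Rintegral do rewrite mul0r cos0.
  by rewrite !Rintegral_prob_cst.
have polyE p : \int[P]_x p.[half_cos2 (theta x)] = \int[P']_x p.[half_cos2 (theta' x)].
  by rewrite !integral_horner_half_cos2//; apply: eq_bigr => i _; rewrite mixedE.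
have ip d0 (T0 : measurableType d0) (P0 : probability T0 R) t n :
    measurable_fun setT t ->
    (\int[P0]_x (step_poly tau n).[half_cos2 (t x)]%:E =
    (\int[P0]_x (step_poly tau n).[half_cos2 (t x)])%:E)%E.
  move=> mt0; apply: Rintegral_fin; apply: (@bounded_integrable _ _ _ _ _ 1).
    exact: measurable_step_poly.
  move=> x; rewrite ger0_norm; last exact: step_poly_ge0 (half_cos2_itv _).
  exact: step_poly_le1 (half_cos2_itv _).
have c1 := @cvg_integral_step_poly _ _ _ P _ mt _ t0 t1.
have c2 := @cvg_integral_step_poly _ _ _ P' _ mt' _ t0 t1.
have e : (fun n => \int[P]_x (step_poly tau n).[half_cos2 (theta x)]%:E)%E =
    (fun n => \int[P']_x (step_poly tau n).[half_cos2 (theta' x)]%:E)%E.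
  by apply/funext => n; rewrite !ip// polyE.
by move: c2; rewrite -e => c2; apply: (cvg_unique _ c1 c2).
Qed.

(** * Laws on the negative half-line *)

Section ComplexPlane.
Local Open Scope complex_scope.
Variable R : realType.

Lemma normc_real (x : R) : Normc.normc x%:C = `|x|.
Proof. by rewrite /= expr0n/= addr0 sqrtr_sqr. Qed.

Lemma normr_Re_le (z : R[i]) : `|Re z| <= Normc.normc z.
Proof.
by case: z => a b /=; rewrite -sqrtr_sqr ler_wsqrtr// lerDl sqr_ge0.
Qed.

Lemma normr_Im_le (z : R[i]) : `|Im z| <= Normc.normc z.
Proof.
by case: z => a b /=; rewrite -sqrtr_sqr ler_wsqrtr// lerDr sqr_ge0.
Qed.

Lemma continuous_complex_real (f : R[i] -> R) :
  (forall z w, `|f z - f w| <= Normc.normc (z - w)) -> continuous f.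
Proof.
move=> fl z; have FF : Filter (nbhs z) by typeclasses eauto.
apply/(@cvgrPdist_lt _ _ _ _ FF) => e e0.
have ec : 0 < e%:C by rewrite ltcR.
apply: filterS (nbhsx_ballx z _ ec) => w.
rewrite -ball_normE /= -[`|z - w|]/((Normc.normc (z - w))%:C) ltcR.
exact: le_lt_trans.
Qed.

Lemma continuous_Re : continuous (@Re R : R[i] -> R).
Proof.
apply: continuous_complex_real => z w; apply: le_trans (normr_Re_le _).
by rewrite raddfB.
Qed.

Lemma continuous_Im : continuous (@Im R : R[i] -> R).
Proof.
apply: continuous_complex_real => z w; apply: le_trans (normr_Im_le _).
by rewrite raddfB.
Qed.

Lemma continuous_real_complex : continuous (real_complex R : R -> R[i]).
Proof.
move=> x; apply/cvgrPdist_lt => e e0.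
have e0' : 0 < Re e by case: e e0 => a b; rewrite ltcE/= => /andP[].
have eE : e = (Re e)%:C by case: e e0 {e0'} => a b; rewrite ltcE/= => /andP[/eqP ->].
apply: filterS (nbhsx_ballx x _ e0') => y; rewrite -ball_normE /= => xy.
by rewrite eE -rmorphB -[`|_|]/((Normc.normc (x - y)%:C)%:C) ltcR normc_real.
Qed.

Lemma continuous_measurable_borelC (f : R[i] -> R) : continuous f ->
  measurable_fun setT (f : borelC R -> R).
Proof.
move=> /continuousP cf; apply: (measurability _ (RGenOInfty.measurableE R)) => //.
move=> _ [_ [a ->] <-]; rewrite setTI; apply: sub_sigma_algebra.
by apply: cf; exact: interval_open.
Qed.

Lemma measurable_real_complex :
  measurable_fun setT (real_complex R : R -> borelC R).
Proof.
apply: (@measurability _ _ _ _ setT (real_complex R : R -> borelC R)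
  (@open (complex R))) => //.
move=> _ [A oA <-]; rewrite setTI; apply: open_measurable.
by move/continuousP : continuous_real_complex; exact.
Qed.

Lemma embedCE (A : set R) : embedC A =
  (@Re R @^-1` A `&` @Im R @^-1` [set 0] : set (borelC R)).
Proof.
apply/seteqP; split => [_ [x Ax <-]//|[a b] /= [Aa ->]].
by exists a.
Qed.

Lemma measurable_embedC (A : set R) : measurable A -> measurable (embedC A).
Proof.
move=> mA; rewrite embedCE; apply: measurableI; rewrite -[X in measurable X]setTI.
  exact: (continuous_measurable_borelC continuous_Re).
by apply: (continuous_measurable_borelC continuous_Im) => //; exact: measurable_set1.
Qed.

(** The inverse of [t |-> - tan^2 t] from [[0, pi / 2)] to the negative
    half-line. *)
Definition half_angle (x : R) : R := atan (Num.sqrt (- x)).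

Definition angle (z : borelC R) : R := 2 * half_angle (Re z).

Lemma continuous_half_angle : continuous half_angle.
Proof.
move=> x; rewrite /half_angle.
apply: (@continuous_comp _ _ _ (fun x => Num.sqrt (- x)) (@atan R)).
  apply: (@continuous_comp _ _ _ (fun x : R => - x) (@Num.sqrt R)).
    exact: opp_continuous.
  exact: sqrt_continuous.
exact: continuous_atan.
Qed.

Lemma measurable_angle : measurable_fun setT angle.
Proof.
apply: measurable_funM => //.
apply: (@measurableT_comp _ _ _ _ _ _ half_angle _ (@Re R : borelC R -> R)); last first.
  exact: (continuous_measurable_borelC continuous_Re).
by apply: continuous_measurable_fun; exact: continuous_half_angle.
Qed.

Lemma cos_half_angle2 x : x <= 0 -> cos (half_angle x) ^+ 2 = (1 - x)^-1.
Proof.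
move=> x0; rewrite /half_angle cos_atan exprVn !sqr_sqrtr ?oppr_ge0//.
by rewrite addr_ge0// oppr_ge0.
Qed.

Lemma cos_angle x : x <= 0 -> cos (angle x%:C) = 2 / (1 - x) - 1.
Proof.
move=> x0; rewrite /angle/= mulr_natl cos_mulr2n cos_half_angle2//.
by rewrite -mulr_natl.
Qed.

Lemma logmod_real (x : R) : x != 0 -> logmod (x%:C) = (ln `|x|)%:E.
Proof.
by move=> x0; rewrite /logmod normc_real lne_EFin// normr_gt0.
Qed.

Lemma logmod0 : logmod (0 : R[i]) = -oo%E.
Proof. by rewrite /logmod Normc.normc0 le0_lneNy. Qed.

(** Under [x = - tan^2 (a / 2)] one has [cos a = 2 / (1 - x) - 1], so that
    [cos a - cos b = 2 (x - y) / ((1 - x) (1 - y))]; on the diagonal both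
    kernels are infinite. *)
Lemma log_kernel_real (x y : R) : x <= 0 -> y <= 0 ->
  log_kernel x%:C y%:C = angle_kernel (angle x%:C) (angle y%:C).
Proof.
move=> x0 y0.
have x1 : 0 < 1 - x by rewrite subr_gt0 (le_lt_trans x0).
have y1 : 0 < 1 - y by rewrite subr_gt0 (le_lt_trans y0).
rewrite /log_kernel -(rmorph1 (real_complex R)) -!rmorphB/=.
rewrite (@logmod_real (1 - x)) ?gt_eqF// (@logmod_real (1 - y)) ?gt_eqF// !gtr0_norm//.
rewrite /angle_kernel !cos_angle//.
have cE : 2 / (1 - x) - 1 - (2 / (1 - y) - 1) = 2 * (x - y) / ((1 - x) * (1 - y)).
  by field; rewrite !gt_eqF.
rewrite -subr_eq0 cE.
case: eqVneq => [h|h].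
  have xy : x - y = 0.
    apply/eqP; move/eqP : h; rewrite !mulf_eq0 invr_eq0 mulf_eq0.
    by rewrite pnatr_eq0 (gt_eqF x1) (gt_eqF y1) !orbF.
  by rewrite xy rmorph0 logmod0.
have xy : x - y != 0.
  by apply: contra_neq h => ->; rewrite mulr0 mul0r.
rewrite logmod_real// -!EFinD; congr EFin.
have xy0 : 0 < `|x - y| by rewrite normr_gt0.
have -> : 4 * (2 * (x - y) / ((1 - x) * (1 - y))) ^+ 2 =
    (4 * `|x - y| / ((1 - x) * (1 - y))) ^+ 2.
  rewrite !exprMn real_normK ?num_real//; ring.
rewrite lnXn ?divr_gt0 ?mulr_gt0// ln_div ?posrE ?mulr_gt0//.
by rewrite [ln (4 * _)]lnM ?posrE// lnM ?posrE// ln4; field.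
Qed.

Lemma measurable_lne_EFin : measurable_fun setT (fun x : R => lne x%:E).
Proof.
rewrite (_ : (fun x : R => _) = (fun x : R => if x <= 0 then -oo%E else (ln x)%:E)).
  apply: measurable_fun_ifT => //.
    exact: measurable_fun_ler.
  by apply/measurable_EFinP; exact: measurable_ln.
apply/funext => x; case: (leP x 0) => x0; first by rewrite le0_lneNy.
by rewrite lne_EFin.
Qed.

(** The difference is handled through the real and imaginary parts because [f]
    and [g] are only known to be measurable for the Borel sets of the plane,
    and not jointly for those of its square. *)
Lemma measurable_logmod_sub d (T : measurableType d) (f g : T -> borelC R) :
  measurable_fun setT f -> measurable_fun setT g ->
  measurable_fun setT (fun x => logmod (f x - g x)).
Proof.
move=> mf mg.
have mre := continuous_measurable_borelC continuous_Re.
have mim := continuous_measurable_borelC continuous_Im.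
apply: (measurableT_comp measurable_lne_EFin).
rewrite (_ : (fun x => _) = (fun x => Num.sqrt ((Re (f x) - Re (g x)) ^+ 2 +
    (Im (f x) - Im (g x)) ^+ 2))); last first.
  by apply/funext => x; case: (f x) => a b; case: (g x) => a' b'.
apply: measurableT_comp.
  by apply: continuous_measurable_fun; exact: sqrt_continuous.
apply: measurable_funD; apply: measurable_funX; apply: measurable_funB.
- exact: (measurableT_comp mre mf).
- exact: (measurableT_comp mre mg).
- exact: (measurableT_comp mim mf).
- exact: (measurableT_comp mim mg).
Qed.

Lemma measurable_log_kernel :
  measurable_fun setT (fun z : borelC R * borelC R => log_kernel z.1 z.2).
Proof.
have m1 := @measurable_fst _ _ (borelC R) (borelC R).
have m2 := @measurable_snd _ _ (borelC R) (borelC R).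
have m0 : measurable_fun setT (fun z : borelC R * borelC R => (1 : borelC R)).
  exact: measurable_cst.
apply: emeasurable_funB; last exact: measurable_logmod_sub m1 m2.
apply: emeasurable_funD; first exact: measurable_logmod_sub m0 m1.
exact: measurable_logmod_sub m0 m2.
Qed.

Lemma measurable_Rminus : measurable (@Rminus R).
Proof.
have -> : @Rminus R = `]-oo, 0]%classic by rewrite set_itvE.
exact: measurable_itv.
Qed.

Lemma integral_log_kernel (mu : M1 R) : M1_Rminus mu ->
  (\int[mu \x mu]_zw log_kernel zw.1 zw.2 = angle_energy mu angle)%E.
Proof.
move=> hmu; apply: ae_eq_integral => //.
- exact: measurable_log_kernel.
- exact: measurable_angle_kernel measurable_angle.
have mR : measurable (embedC (@Rminus R)).
  exact: measurable_embedC measurable_Rminus.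
exists (~` (embedC (@Rminus R) `*` embedC (@Rminus R))); split.
- by apply: measurableC; exact: measurableX.
- have := @probability_setC _ _ _ (mu \x mu)%E _ (measurableX mR mR).
  rewrite [X in (_ - X)%E](_ : _ = 1%E) ?subee//.
  apply: etrans (product_measure1E mu mu mR mR) _.
  rewrite [X in (X * _)%E](_ : _ = 1%E) ?[X in (_ * X)%E](_ : _ = 1%E) ?mule1//;
  exact: hmu.
- move=> [z w] /= + [[x x0 xz] [y y0 yw]]; apply => _.
  by rewrite -xz -yw log_kernel_real.
Qed.

End ComplexPlane.

(** * The extremal law as an image of the uniform law *)

Section UniformLaw.
Local Open Scope complex_scope.
Variable R : realType.
Local Notation lambda := (@lebesgue_measure R).

Definition U01 : probability (measurableTypeR R) R := uniform_prob (@ltr01 R).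

Lemma ge0_integral_U01 (f : R -> \bar R) :
  measurable_fun setT f -> (forall x, 0 <= f x)%E ->
  (\int[U01]_t f t = \int[lambda]_(t in `[0%R, 1%R]) f t)%E.
Proof.
by move=> mf f0; rewrite integral_uniform// subr0 invr1 mul1e.
Qed.

Lemma U01E (A : set R) : measurable A -> U01 A = lambda (A `&` `[0, 1]).
Proof.
move=> mA; rewrite -[X in U01 X]setIT -integral_indic// ge0_integral_U01//.
- by rewrite integral_indic.
- by apply/measurable_EFinP; exact: measurable_indic.
Qed.

Lemma ae_U01 : {ae U01, forall t, 0 < t < 1}.
Proof.
have m01 : measurable (`]0, 1[%classic : set R) by exact: measurable_itv.
exists (~` `]0, 1[%classic); split.
- exact: measurableC.
- apply: etrans (U01E (measurableC m01)) _.
  apply/eqP; rewrite eq_le measure_ge0 andbT.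
  apply: (@le_trans _ _ (lambda ([set 0] `|` [set 1]))).
    apply: le_measure; rewrite ?inE//.
      by apply: measurableI => //; exact: measurableC.
      by apply: measurableU; exact: measurable_set1.
    move=> t [/= h]; rewrite in_itv/= => /andP[t0 t1].
    case: (eqVneq t 0) => [->|tn0]; first by left.
    case: (eqVneq t 1) => [->|tn1]; first by right.
    exfalso; apply: h; rewrite in_itv/= !lt_neqAle t0 t1 eq_sym tn0 tn1//.
  apply: le_trans (measureU2 _ _ _) _; try exact: measurable_set1.
  by rewrite /= !lebesgue_measure_set1 adde0.
- by move=> t /= h; contradict h; rewrite in_itv/= in h.
Qed.

Lemma cos_moment_U01 n : cos_moment U01 (fun t => pi * t) n.+1 = 0.
Proof.
pose c : R := n.+1%:R * pi.
have c0 : c != 0 by rewrite mulf_neq0 ?gt_eqF ?pi_gt0.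
have mc : measurable_fun setT (fun t : R => cos (c * t)).
  apply: (@measurableT_comp _ _ _ _ _ _ (@cos R)); last exact: measurable_funM.
  by apply: continuous_measurable_fun; exact: continuous_cos.
have ic : U01.-integrable setT (EFin \o (fun t => cos (c * t))).
  by apply: (@bounded_integrable _ _ _ _ _ 1) => // t; exact: cos_max.
rewrite /cos_moment; under eq_Rintegral do rewrite mulrA -/c.
(* Adding 1 makes the integrand nonnegative, as ge0_integral_U01 requires. *)
have : \int[U01]_t (1 + cos (c * t)) = 1.
  rewrite /Rintegral ge0_integral_U01; last 2 first.
  - by apply/measurable_EFinP; exact: measurable_funD.
  - by move=> t; rewrite lee_fin -lerBlDl sub0r cos_geN1.
  pose F (t : R) : R := t + c^-1 * sin (c * t).
  have dF (t : R) : is_derive t 1 F (1 + cos (c * t)).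
    have h1 := is_deriveZ c (is_derive_id t (1 : R)).
    have h2 := @is_derive1_comp R (@sin R) (c *: id) t _ _
      (is_derive_sin ((c *: id) t)) h1.
    have h3 := is_deriveD (is_derive_id t (1 : R)) (is_deriveZ c^-1 h2).
    apply: is_derive_eq; rewrite /GRing.scale/=.
    by rewrite mulr1 mulrCA mulVf// mulr1.
  have cF : continuous F.
    move=> t; apply: differentiable_continuous; apply/derivable1_diffP.
    exact: ex_derive.
  have sin0n m : sin (m%:R * pi) = 0 :> R.
    elim: m => [|m IH]; first by rewrite mul0r sin0.
    by rewrite -natr1 mulrDl mul1r sinDpi IH oppr0.
  rewrite (@continuous_FTC2 _ _ F) ?ltr01//.
  - by rewrite /F mulr1 mulr0 sin0 /c sin0n !mulr0 !addr0 sube0.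
  - apply: continuous_subspaceT => t; apply: cvgD; first exact: cvg_cst.
    apply: (@continuous_comp _ _ _ (fun t => c * t) (@cos R)).
      exact: mulrl_continuous.
    exact: continuous_cos.
  - split.
    + by move=> t _; exact: ex_derive.
    + by apply: cvg_at_right_filter; exact: cF.
    + by apply: cvg_at_left_filter; exact: cF.
  - by move=> t _; rewrite derive1E; exact: derive_val.
rewrite RintegralD//; last exact: integrable_prob_cst.
by rewrite Rintegral_prob_cst => /eqP; rewrite addrC -subr_eq0 addrK => /eqP.
Qed.

(** This is [- tan^2 (pi t / 2)] (see [root_ofE]), the point at angle [pi t].
    The real power [-1] is a measurable function, and it agrees with the inverse
    at 0 too. *)
Definition root_of (t : R) : R :=
  - (sin (pi * t / 2) ^+ 2 * (cos (pi * t / 2) ^+ 2) `^ (- 1)).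

Lemma root_ofE t : root_of t = - tan (pi * t / 2) ^+ 2.
Proof. by rewrite /root_of powR_inv1 ?sqr_ge0// /tan expr_div_n. Qed.

Lemma measurable_root_of : measurable_fun setT root_of.
Proof.
have ma : measurable_fun setT (fun t : R => pi * t / 2).
  by apply: measurable_funM => //; exact: measurable_funM.
apply: measurableT_comp => //; apply: measurable_funM.
  apply: measurable_funX; apply: measurableT_comp ma.
  by apply: continuous_measurable_fun; exact: continuous_sin.
apply: (measurableT_comp (measurable_powR (- 1))).
apply: measurable_funX; apply: measurableT_comp ma.
by apply: continuous_measurable_fun; exact: continuous_cos.
Qed.

Lemma root_of_le0 t : root_of t <= 0.
Proof. by rewrite root_ofE oppr_le0 sqr_ge0. Qed.

Lemma half_pi_itv (t : R) : 0 < t < 1 -> pi * t / 2 \in `](- (pi / 2)), (pi / 2)[.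
Proof.
move=> /andP[t0 t1]; have p0 := pi_gt0 R.
rewrite in_itv/=; apply/andP; split; nra.
Qed.

Lemma angle_root_of t : 0 < t < 1 -> angle (root_of t)%:C = pi * t.
Proof.
move=> t01; have p0 := pi_gt0 R; have /andP[t0 t1] := t01.
have h := half_pi_itv t01.
have h0 : 0 <= tan (pi * t / 2).
  rewrite -tan0 -[_ <= _]negbK -ltNge ltr_tan ?h//.
    by rewrite -leNgt divr_ge0// mulr_ge0 ?ltW.
  by rewrite in_itv/= oppr_lt0 !divr_gt0.
rewrite /angle /half_angle/= root_ofE opprK sqrtr_sqr ger0_norm// tanK//.
by rewrite mulrC divfK.
Qed.

Lemma continuous_root_of t : 0 < t < 1 -> {for t, continuous root_of}.
Proof.
move=> t01.
have -> : root_of = (fun t => - tan (pi * t / 2) ^+ 2).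
  by apply/funext => u; rewrite root_ofE.
have ct : tan (pi * u / 2) @[u --> t] --> tan (pi * t / 2).
  apply: (@continuous_comp _ _ _ (fun u : R => pi * u / 2) (@tan R)).
    by apply: cvgMr_tmp; apply: cvgMl_tmp; exact: cvg_id.
  apply: continuous_tan; rewrite gt_eqF// cos_gt0_pihalf//.
  by have := half_pi_itv t01; rewrite in_itv.
by apply: cvgN; rewrite expr2; apply: cvgM.
Qed.

Section Law.
Variables (g : R -> R) (mg : measurable_fun setT g).

Definition real_point (t : measurableTypeR R) : borelC R := (g t)%:C.

Lemma measurable_real_point : measurable_fun setT real_point.
Proof. exact: (measurableT_comp (@measurable_real_complex R) mg). Qed.

HB.instance Definition _ := isMeasurableFun.Build _ _ _ _ _ measurable_real_point.

(** The law of [g] at a uniform point of [[0, 1]], as a law on the plane. *)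
Definition law : M1 R := distribution U01 real_point.

Lemma lawE A : law A = U01 (real_point @^-1` A).
Proof. by []. Qed.

Lemma integral_law (f : borelC R -> R) M : measurable_fun setT f ->
  (forall z, `|f z| <= M) ->
  (\int[law]_z (f z)%:E = \int[U01]_t (f (g t)%:C)%:E)%E.
Proof.
move=> mf fM; rewrite (@integral_distribution _ _ _ _ _ U01 real_point)//.
- exact/measurable_EFinP.
- apply: (@bounded_integrable _ _ _ U01 (f \o real_point) M).
    exact: (measurableT_comp mf measurable_real_point).
  by move=> t; exact: fM.
Qed.

End Law.

End UniformLaw.

(** * The extremal law is a limit of empirical measures *)

Section RiemannSums.
Variable R : realType.
Local Notation lambda := (@lebesgue_measure R).

(** Midpoints, and not endpoints, of the subdivision: the corresponding roots
    are then neither 0 nor at infinity. *)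
Definition midpoint (n k : nat) : R := (k%:R + 2^-1) / n%:R.

Definition step_point (n : nat) (t : R) : R :=
  ((Num.floor (n%:R * t))%:~R + 2^-1) / n%:R.

Lemma step_pointE n k t : (0 < n)%N ->
  k%:R / n%:R <= t < k.+1%:R / n%:R -> step_point n t = midpoint n k.
Proof.
move=> n0 /andP[kt tk]; have n0' : 0 < n%:R :> R by rewrite ltr0n.
rewrite /step_point /midpoint (@floor_def _ _ k)//.
rewrite intrD mulr1z -!pmulrn natr1; apply/andP; split.
  by rewrite mulrC -ler_pdivrMr.
by rewrite mulrC -ltr_pdivlMr.
Qed.

Lemma midpoint_itv n k : (k < n)%N -> 0 < midpoint n k < 1.
Proof.
move=> kn; have n0' : 0 < n%:R :> R by rewrite ltr0n (leq_trans _ kn).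
rewrite /midpoint divr_gt0 ?ltr_wpDl//= ltr_pdivrMr// mul1r.
have : k.+1%:R <= n%:R :> R by rewrite ler_nat.
rewrite -natr1; lra.
Qed.

Lemma measurable_step_point n : measurable_fun setT (step_point n).
Proof.
apply: nondecreasing_measurable => // x y xy.
rewrite /step_point ler_wpM2r ?invr_ge0// lerD2r ler_int.
by apply: le_floor; rewrite ler_wpM2l.
Qed.

Lemma cvg_step_point t : step_point n t @[n --> \oo] --> t.
Proof.
apply/cvgrPdist_le => e e0; near=> n.
have n0 : (0 < n)%N by near: n; exact: nbhs_infty_gt.
have n0' : 0 < n%:R :> R by rewrite ltr0n.
have := floor_itv (n%:R * t); rewrite intrD => /andP[h1 h2].
have ne : 1 <= n%:R * e.
  rewrite -ler_pdivrMr// mul1r; near: n.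
  exact: nbhs_infty_ger.
rewrite -(ler_pM2l n0') -[X in X * `|_|](gtr0_norm n0') -normrM mulrBr.
rewrite /step_point [n%:R * (_ / _)]mulrC divfK ?gt_eqF//.
by rewrite ler_norml; apply/andP; split; lra.
Unshelve. all: by end_near. Qed.

(** On each interval of the subdivision [step_point n] is constant, equal to the
    midpoint. *)
Lemma integral_step (n : nat) (h : R -> R) : (0 < n)%N ->
  measurable_fun setT h -> (forall x, 0 <= h x) ->
  (\int[@U01 R]_t (h (step_point n t))%:E =
   (n%:R^-1)%:E * \sum_(k < n) (h (midpoint n k))%:E)%E.
Proof.
move=> n0 mh h0.
have n0' : 0 < n%:R :> R by rewrite ltr0n.
have mf : measurable_fun setT (fun t => (h (step_point n t))%:E).
  by apply/measurable_EFinP; exact: (measurableT_comp mh (measurable_step_point n)).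
rewrite ge0_integral_U01//; last by move=> t; rewrite lee_fin.
pose F k : set R := `[k%:R / n%:R, k.+1%:R / n%:R[%classic.
have mF k : measurable (F k) by exact: measurable_itv.
rewrite -integral_itv_bndo_bndc; last exact: measurable_funTS.
have FE m : `[0%R, m%:R / n%:R[%classic = \big[setU/set0]_(k < m) F k.
  elim: m => [|m IH]; first by rewrite big_ord0 mul0r set_itvco0.
  rewrite big_ord_recr/= -IH; rewrite /F -itv_bndbnd_setU// bnd_simp ?divr_ge0//.
  by rewrite ler_pM2r ?invr_gt0// ler_nat.
have -> : `[0%R, 1%R[%classic = \big[setU/set0]_(k <- iota 0 n) F k.
  by rewrite -[X in iota _ X]subn0 big_mkord -FE divff ?gt_eqF.
rewrite ge0_integral_bigsetU//; last 4 first.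
- exact: iota_uniq.
- apply: (@sub_trivIset _ _ _ setT) => //.
  apply/trivIsetP => i j _ _ ij.
  wlog : i j ij / (i < j)%N.
    move=> hw; case: (ltngtP i j) => [lij|lji|eij]; first exact: hw.
      by rewrite setIC; apply: hw; rewrite // eq_sym.
    by rewrite eij eqxx in ij.
  move=> lij; apply/seteqP; split => // t []; rewrite /F/= !in_itv/=.
  move=> /andP[_ ti] /andP[jt _].
  have : i.+1%:R / n%:R <= j%:R / n%:R :> R by rewrite ler_pM2r ?invr_gt0// ler_nat.
  by move=> /(lt_le_trans ti)/lt_le_trans/(_ jt); rewrite ltxx.
- exact: measurable_funTS.
- by move=> t _; rewrite lee_fin.
rewrite -[X in iota _ X]subn0 big_mkord ge0_sume_distrr; last first.
  by move=> i _; rewrite lee_fin.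
apply: eq_bigr => k _.
transitivity (\int[lambda]_(t in F k) (h (midpoint n k))%:E)%E.
  apply: eq_integral => t; rewrite inE /F/= in_itv/= => tk.
  by rewrite (step_pointE n0 tk).
have lF : lambda (F k) = (n%:R^-1)%:E.
  rewrite /F lebesgue_measure_itv/= lte_fin ltr_pM2r ?invr_gt0// ltr_nat ltnSn.
  by rewrite -EFinB -mulrBl -natr1 addrAC subrr add0r mul1r.
rewrite integral_cst; last exact: mF.
by rewrite [RHS]muleC; congr (_ * _)%E; exact: lF.
Qed.

End RiemannSums.

(** Multiplying by [X - z] with [z < 0] adds positive multiples of consecutive
    coefficients. *)
Lemma prod_XsubC_coef_gt0 (F : numDomainType) (s : seq F) :
  (forall z, z \in s -> z < 0) ->
  forall i, (i < size (\prod_(z <- s) ('X - z%:P))%R)%N ->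
    0 < (\prod_(z <- s) ('X - z%:P))`_i.
Proof.
elim: s => [|z s IH] hs i.
  by rewrite big_nil size_poly1 ltnS leqn0 => /eqP ->; rewrite coefC eqxx ltr01.
have {}IH := IH (fun y (ys : y \in s) => hs y (mem_behead (s := z :: s) ys)).
have z0 : 0 < - z by rewrite oppr_gt0 hs// mem_head.
rewrite size_prod_XsubC/= big_cons; set p := \prod_(_ <- s) _ in IH *.
have sp : size p = (size s).+1 by rewrite size_prod_XsubC.
have p0 j : 0 <= p`_j.
  have [js|js] := ltnP j (size p); first exact: ltW (IH _ js).
  by rewrite nth_default.
rewrite mulrBl coefB coefXM coefCM -mulNr.
case: i => [_|i iS]; first by rewrite add0r mulr_gt0// IH// sp.
by rewrite ltr_wpDr ?mulr_ge0 ?(ltW z0)//= IH// sp.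
Qed.

Lemma zeros_prod_XsubC (R : realType) (s : seq R[i]) :
  perm_eq (zeros (\prod_(z <- s) ('X - z%:P))) s.
Proof.
rewrite /zeros; case: closed_field_poly_normal => t /= pE.
by apply: prod_XsubC_eq; rewrite [in RHS]pE (monicP (monic_prod_XsubC _ _ _)) scale1r.
Qed.

Section CalP.
Local Open Scope complex_scope.
Variable R : realType.

Definition midpoint_roots (n : nat) : seq R[i] :=
  [seq (root_of (midpoint R n k))%:C | k <- iota 0 n].

Definition midpoint_poly (n : nat) : {poly R[i]} :=
  \prod_(z <- midpoint_roots n) ('X - z%:P).

Lemma root_of_lt0 (t : R) : 0 < t < 1 -> root_of t < 0.
Proof.
move=> t01; rewrite root_ofE oppr_lt0 exprn_gt0//.
have /andP[t0 t1] := t01; have p0 := pi_gt0 R.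
rewrite -tan0 ltr_tan ?half_pi_itv//; first by rewrite divr_gt0// mulr_gt0.
by rewrite in_itv/= oppr_lt0 !divr_gt0.
Qed.

Lemma pol_plus_midpoint_poly n : (0 < n)%N -> pol_plus (midpoint_poly n).
Proof.
move=> n0; split.
  by rewrite size_prod_XsubC size_map size_iota.
apply: prod_XsubC_coef_gt0 => z /mapP[k]; rewrite mem_iota add0n => kn ->.
by rewrite -(rmorph0 (real_complex R)) ltcR root_of_lt0// midpoint_itv.
Qed.

Lemma empirical_midpoint_poly n (A : set (borelC R)) :
  empirical (midpoint_poly n) A =
  ((n%:R^-1)%:E * \sum_(k < n) (\1_A ((root_of (midpoint R n k))%:C : borelC R))%:E)%E.
Proof.
have zp := zeros_prod_XsubC (midpoint_roots n).
rewrite /empirical (perm_size zp) size_map size_iota; congr (_ * _)%E.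
rewrite (perm_big _ zp)/= big_map -[X in iota _ X]subn0 big_mkord.
by apply: eq_bigr => k _; rewrite diracE indicE.
Qed.

Lemma measurable_stepped_root n : measurable_fun setT (@root_of R \o @step_point R n).
Proof.
exact: (measurableT_comp (@measurable_root_of R) (@measurable_step_point R n)).
Qed.

Definition midpoint_law n : M1 R := law (measurable_stepped_root n).

Definition extremal_law : M1 R := law (@measurable_root_of R).

(** Realising the empirical measure as a law on the same probability space as
    its limit reduces weak convergence to dominated convergence. *)
Lemma midpoint_lawE n (A : set (borelC R)) : (0 < n)%N -> measurable A ->
  midpoint_law n A = empirical (midpoint_poly n) A.
Proof.
move=> n0 mA; rewrite empirical_midpoint_poly.
have mx : measurable_fun setT (fun x : R => ((root_of x)%:C : borelC R)).
  exact: (measurableT_comp (@measurable_real_complex R) (@measurable_root_of R)).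
rewrite -(@integral_step R n (fun x => \1_A ((root_of x)%:C : borelC R)))//; last first.
  by apply: (measurableT_comp _ mx); exact: measurable_indic.
pose B := real_point (@root_of R \o @step_point R n) @^-1` A.
have mB : measurable B.
  rewrite -[B]setTI; apply: measurable_real_point => //; exact: measurable_stepped_root.
transitivity (\int[@U01 R]_t (\1_B t)%:E)%E; last by apply: eq_integral.
by rewrite integral_indic// setIT.
Qed.

Lemma empirical_midpoint_law n : (0 < n)%N ->
  @empirical_measures R (midpoint_law n).
Proof.
move=> n0; exists (midpoint_poly n); first exact: pol_plus_midpoint_poly.
by move=> A mA; exact: midpoint_lawE.
Qed.

Lemma cvg_midpoint_law (f : R[i] -> R) : continuous f -> bounded_fun f ->
  \int[midpoint_law n]_z (f z) @[n --> \oo] --> \int[extremal_law]_z (f z).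
Proof.
move=> cf [M0 [_ fM0]].
have [M fM] : exists M : R, forall z, `|f z| <= M.
  by exists (`|M0| + 1) => z; apply: fM0 => //; rewrite ltr_pwDr// ler_norm.
have mf := continuous_measurable_borelC cf.
have mx (g : R -> R) (mg : measurable_fun setT g) :
    measurable_fun setT (fun x : R => f (g x)%:C).
  exact: (measurableT_comp mf (measurableT_comp (@measurable_real_complex R) mg)).
apply: fine_cvg.
rewrite fineK; last first.
  apply: integrable_fin_num => //.
  exact: (@bounded_integrable _ _ _ extremal_law _ M).
rewrite (integral_law _ mf fM).
rewrite (_ : (fun n => _) = (fun n =>
  (\int[@U01 R]_t (f (root_of (step_point n t))%:C)%:E)%E)); last first.
  by apply/funext => n; rewrite (integral_law _ mf fM).
have [] := @dominated_convergence _ _ _ (@U01 R) setT measurableT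
  (fun n t => (f (root_of (step_point n t))%:C)%:E)
  (fun t => (f (root_of t)%:C)%:E) (cst M%:E) _ _ _ _ _ => //.
- by move=> n; apply/measurable_EFinP; apply: mx; exact: measurable_stepped_root.
- by apply/measurable_EFinP; apply: mx; exact: measurable_root_of.
- have FF : Filter (almost_everywhere (@U01 R)) := ae_filter_ringOfSetsType _.
  apply: filterS (@ae_U01 R) => t t01 _; apply: cvg_EFin; first exact: nearW.
  apply: (@cvg_comp _ _ _ (fun n => root_of (step_point n t))
      (fun x => f x%:C) _ (nbhs (root_of t))).
    apply: (@cvg_comp _ _ _ (fun n => step_point n t) (@root_of R) _ (nbhs t)).
      exact: cvg_step_point.
    exact: continuous_root_of.
  apply: (@continuous_comp _ _ _ (real_complex R) f).
    exact: continuous_real_complex.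
  exact: cf.
- exact: integrable_prob_cst.
- by apply: aeW => t n _; rewrite lee_fin.
Qed.

(** The weak topology is the initial topology for the test integrals, so
    [cvg_midpoint_law], one test function at a time, is all that is needed. *)
Lemma extremal_law_calP : @calP R extremal_law.
Proof.
have cv : (midpoint_law n : weakM1 R) @[n --> \oo] --> (extremal_law : weakM1 R).
  move=> B; rewrite nbhsE => -[C [[V oV <-] Vl] VB].
  have c : test_integrals (midpoint_law n) @[n --> \oo] --> test_integrals extremal_law.
    apply/cvg_sup => f U.
    have /= -> := @nbhsE (initial_topology
      (fun g : {ptws @bounded_continuous R -> R} => g f)) (test_integrals extremal_law).
    case=> W [[D oD <-] Dl] DU.
    have [cf bf] := set_valP f.
    have := cvg_midpoint_law cf bf (open_nbhs_nbhs (conj oD Dl)).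
    rewrite !nbhs_simpl/= => h; near=> n; apply: DU; near: n; exact: h.
  apply: filterS VB _; apply: c; exact: open_nbhs_nbhs.
move=> B /cv; rewrite nbhs_simpl/= => hB.
have [n [Bn n0]] : exists n, B (midpoint_law n) /\ (0 < n)%N.
  have [N _ hN] := filterI hB (nbhs_infty_gt 0).
  by exists N; apply: hN => /=.
by exists (midpoint_law n); split => //; exact: empirical_midpoint_law.
Unshelve. all: by end_near. Qed.

End CalP.

(** * The minimizer *)

Section Minimizer.
Local Open Scope complex_scope.
Variable R : realType.
Implicit Type mu : M1 R.

Lemma probability_setI1 d (T : measurableType d) (P : probability T R) (A D : set T) :
  measurable A -> measurable D -> P D = 1%E -> P (A `&` D) = P A.
Proof.
move=> mA mD D1.
have DC : P (~` D) = 0%E by rewrite probability_setC// D1 subee.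
apply/eqP; rewrite eq_le; apply/andP; split.
  by apply: le_measure; rewrite ?inE//; exact: measurableI.
rewrite -[X in (P X <= _)%E](setIT A) -(setUv D) setIUr.
apply: le_trans (measureU2 _ _ _) _.
- exact: measurableI.
- by apply: measurableI => //; exact: measurableC.
rewrite -[leRHS]adde0; apply: leeD => //.
rewrite -DC; apply: le_measure; rewrite ?inE//; try exact: measurableC.
by apply: measurableI => //; exact: measurableC.
Qed.

Lemma M1_Rminus_extremal_law : M1_Rminus (extremal_law R).
Proof.
transitivity (U01 R [set: R]); last exact: probability_setT.
rewrite /extremal_law lawE; congr (U01 R _).
by apply/seteqP; split => // t _; exists (root_of t); first exact: root_of_le0.
Qed.

Lemma cos_moment_extremal_law n : cos_moment (extremal_law R) (@angle R) n.+1 = 0.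
Proof.
rewrite -(cos_moment_U01 R n) /cos_moment /Rintegral; congr fine.
have mc := @measurable_cos_theta _ _ R _ (@measurable_angle R) n.+1.
rewrite (@integral_law _ _ _ _ 1)//; last by move=> z; exact: cos_max.
have mU : measurable_fun setT (fun t : R => cos (n.+1%:R * (pi * t))).
  by apply: (@measurable_cos_theta _ _ R (fun t => pi * t)); exact: measurable_funM.
apply: ae_eq_integral => //.
- apply/measurable_EFinP; apply: (measurableT_comp mc).
  exact: (measurableT_comp (@measurable_real_complex R) (@measurable_root_of R)).
- exact/measurable_EFinP.
have FF : Filter (almost_everywhere (@U01 R)) := ae_filter_ringOfSetsType _.
by apply: filterS (@ae_U01 R) => t t01 _; rewrite angle_root_of.
Qed.

Lemma rate_extremal_law_le : (rate (extremal_law R) <= (ln 2)%:E)%E.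
Proof.
rewrite /rate mem_set; last exact: extremal_law_calP.
rewrite integral_log_kernel; last exact: M1_Rminus_extremal_law.
have := angle_energy_le (@measurable_angle R) cos_moment_extremal_law.
move=> /(lee_wpmul2l (x := (2^-1)%:E)) -/(_ _).
rewrite -EFinM mulKf//; apply; by rewrite lee_fin.
Qed.

(** The energy of the minimizer is at most that of the extremal law, which is
    at most [2 ln 2]; by [angle_energy_ge] nothing is left for the cosine
    moments. Finiteness also puts the minimizer in [calP], where the rate is
    the energy. *)
Lemma cos_moment_minimizer mu : is_minimizer mu ->
  forall n, cos_moment mu (@angle R) n.+1 = 0.
Proof.
move=> [hmu rmu] n.
have : (rate mu <= (ln 2)%:E)%E.
  apply: le_trans rate_extremal_law_le; rewrite rmu; apply: ereal_inf_lbound.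
  by exists (extremal_law R) => //; exact: M1_Rminus_extremal_law.
rewrite /rate; case: ifP => _; last by rewrite leNgt ltry.
rewrite integral_log_kernel// => h1.
have h2 := angle_energy_ge mu (@measurable_angle R) n.
have : ((2^-1)%:E * (2 * ln 2 +
    2 / n.+1%:R * cos_moment mu (@angle R) n.+1 ^+ 2)%:E <= (ln 2)%:E)%E.
  by apply: le_trans h1; apply: lee_wpmul2l => //; rewrite lee_fin.
rewrite -EFinM lee_fin mulrDr mulKf// -lerBrDl subrr.
rewrite -mulrA mulKf// => h.
apply/eqP; rewrite -(sqrf_eq0 (cos_moment mu (@angle R) n.+1)).
rewrite eq_le sqr_ge0 andbT.
by move: h; rewrite pmulr_rle0// invr_gt0.
Qed.

Lemma half_cos2_angle (x : R) : x <= 0 -> half_cos2 (angle x%:C) = (1 - x)^-1.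
Proof.
move=> x0; rewrite /half_cos2 cos_angle// addrC subrK mulrC mulKf//.
Qed.

Lemma angle_real_itv (x : R) : x <= 0 -> 0 <= angle x%:C <= pi.
Proof.
move=> x0; rewrite /angle/= /half_angle; apply/andP; split.
  by rewrite mulr_ge0// -(@atan0 R) le_atan// sqrtr_ge0.
by rewrite mulrC -ler_pdivlMr// ltW// atan_ltpi2.
Qed.

(** [half_cos2] decreases on [[0, pi]], so the set is the interval of the [t]
    with [pi t > angle b]. *)
Lemma U01_ray (b : R) : b <= 0 ->
  U01 R [set t | half_cos2 (pi * t) < (1 - b)^-1] = (1 - angle b%:C / pi)%:E.
Proof.
move=> b0; have p0 := pi_gt0 R.
have /andP[a0 a1] := angle_real_itv b0.
rewrite -half_cos2_angle// U01E; last first.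
  by apply: (@measurable_half_cos2_lt _ _ R (fun t => pi * t)); exact: measurable_funM.
rewrite (_ : _ `&` _ = `]angle b%:C / pi, 1]%classic); last first.
  have tE t : 0 <= t <= 1 ->
      (half_cos2 (pi * t) < half_cos2 (angle b%:C)) = (angle b%:C / pi < t).
    move=> /andP[t0 t1]; rewrite /half_cos2 ltr_pM2r// ltrD2l ltr_cos.
    - by rewrite ltr_pdivrMr// mulrC.
    - by rewrite in_itv/= a0.
    - rewrite in_itv/=; apply/andP; split; first by rewrite mulr_ge0// ltW.
      by rewrite ler_piMr// ltW.
  apply/seteqP; split => t /=; rewrite !in_itv/=.
    by move=> [h t01]; move: h; rewrite tE// => ->; case/andP: t01.
  move=> /andP[bt t1]; have t0 : 0 <= t.
    by apply: le_trans (ltW bt); rewrite divr_ge0// ltW.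
  by rewrite tE ?t0.
rewrite lebesgue_measure_itv/= lte_fin; case: ltP => h; first by rewrite -EFinB.
by congr EFin; apply/eqP; rewrite eq_sym subr_eq0 eq_le h ler_pdivrMr// mul1r.
Qed.

Definition real_part (z : borelC R) : R := Re z.

Lemma measurable_real_part : measurable_fun setT real_part.
Proof. exact: (continuous_measurable_borelC (@continuous_Re R)). Qed.

HB.instance Definition _ := isMeasurableFun.Build _ _ _ _ _ measurable_real_part.

Lemma minimizer_ray mu (b : R) : is_minimizer mu -> b <= 0 ->
  distribution mu real_part `]-oo, b[%classic = (1 - angle b%:C / pi)%:E.
Proof.
move=> hmu b0; have [hR _] := hmu.
have b1 : 0 < 1 - b by rewrite subr_gt0 (le_lt_trans b0).
rewrite -U01_ray//.
have mR := measurable_embedC (@measurable_Rminus R).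
have mp : measurable_fun setT (fun t : R => pi * t) by exact: measurable_funM.
have := @cos_moments_determine_rays R _ _ mu _ _ _ (U01 R) _ (1 - b)^-1
  (@measurable_angle R) mp.
move=> <-.
- rewrite -(@probability_setI1 _ _ mu _ _ _ mR hR); last first.
    exact: measurable_half_cos2_lt (@measurable_angle R) _.
  rewrite /distribution /pushforward -(@probability_setI1 _ _ mu _ _ _ mR hR); last first.
    by rewrite -[X in measurable X]setTI; exact: measurable_real_part.
  have raysE (x : R) : x <= 0 -> (half_cos2 (angle x%:C) < (1 - b)^-1) = (x < b).
    move=> x0; have x1 : 0 < 1 - x by rewrite subr_gt0 (le_lt_trans x0).
    by rewrite half_cos2_angle// ltf_pV2 ?posrE// ltrD2l ltrN2.
  congr (mu _); apply/seteqP; split => z [h [x x0 xz]]; move: h; rewrite -xz/=.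
    by rewrite in_itv/= -raysE// => h; split => //; exists x.
  by rewrite raysE// => h; split; [rewrite in_itv|exists x].
- by move=> n; rewrite cos_moment_minimizer// cos_moment_U01.
- by rewrite invr_gt0.
- by rewrite invf_le1// lerDl oppr_ge0.
Qed.

Local Notation lambda := (@lebesgue_measure R).

Lemma phi_den_ge0 (x : R) : 0 <= x -> 0 <= pi * (x + 1) * Num.sqrt x.
Proof.
by move=> x0; rewrite mulr_ge0 ?sqrtr_ge0// mulr_ge0 ?pi_ge0// addr_ge0.
Qed.

Lemma phi_ge0 (x : R) : 0 <= phi x.
Proof.
by rewrite /phi mulr_ge0// invr_ge0 phi_den_ge0.
Qed.

Lemma phi_lt0E (x : R) : x < 0 -> phi x = (pi * (- x + 1) * Num.sqrt (- x))^-1.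
Proof.
by move=> x0; rewrite /phi indicE mem_set// mulr1 ltr0_norm.
Qed.

Lemma phi_ge0E (x : R) : 0 <= x -> phi x = 0.
Proof.
by move=> x0; rewrite /phi indicE memNset ?mulr0//= => /(le_lt_trans x0); rewrite ltxx.
Qed.

Lemma measurable_phi : measurable_fun setT (@phi R).
Proof.
have mi : measurable_fun setT (fun x : R => (pi * (`|x| + 1) * Num.sqrt `|x|)^-1).
  have -> : (fun x : R => (pi * (`|x| + 1) * Num.sqrt `|x|)^-1) =
      (fun x => (pi * (`|x| + 1) * Num.sqrt `|x|) `^ (- 1)).
    by apply/funext => x; rewrite powR_inv1// phi_den_ge0.
  apply: (measurableT_comp (measurable_powR (- 1))).
  apply: measurable_funM.
    by apply: measurable_funM => //; apply: measurable_funD.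
  apply: (@measurableT_comp _ _ _ _ _ _ (@Num.sqrt R)) => //.
  by apply: continuous_measurable_fun; exact: sqrt_continuous.
apply: measurable_funM mi _; apply: measurable_indic.
have -> : [set y : R | y < 0] = `]-oo, 0[%classic by rewrite set_itvE.
exact: measurable_itv.
Qed.

Definition phi_measure (A : set R) : \bar R := (\int[lambda]_(x in A) (phi x)%:E)%E.

Let phi_measure0 : phi_measure set0 = 0%E.
Proof. by rewrite /phi_measure integral_set0. Qed.

Let phi_measure_ge0 A : (0 <= phi_measure A)%E.
Proof. by apply: integral_ge0 => x _; rewrite lee_fin phi_ge0. Qed.

Let phi_measure_sigma_additive : semi_sigma_additive phi_measure.
Proof.
move=> /= F mF tF mUF; rewrite /phi_measure; apply: cvg_toP.
  apply: ereal_nondecreasing_is_cvgn => m n mn.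
  apply: lee_sum_nneg_natr => // k _ _.
  by apply: integral_ge0 => /= x Fkx; rewrite lee_fin phi_ge0.
rewrite ge0_integral_bigcup//=.
- by apply: measurable_funTS; apply/measurable_EFinP; exact: measurable_phi.
- by move=> x _; rewrite lee_fin phi_ge0.
Qed.

HB.instance Definition _ := isMeasure.Build _ _ _ phi_measure
  phi_measure0 phi_measure_ge0 phi_measure_sigma_additive.

(** A primitive of [x |-> phi (- x)] on the positive half-line. *)
Definition phi_primitive (x : R) : R := 2 / pi * atan (Num.sqrt x).

Lemma is_derive_phi_primitive (x : R) : 0 < x ->
  is_derive x 1 phi_primitive (pi * (x + 1) * Num.sqrt x)^-1.
Proof.
move=> x0; have p0 := pi_gt0 R.
have s0 : 0 < Num.sqrt x by rewrite sqrtr_gt0.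
have h1 := is_derive1_sqrt x0.
have h2 := @is_derive1_comp R (@atan R) (@Num.sqrt R) x _ _ (is_derive1_atan _) h1.
have h3 := is_deriveZ (2 / pi) h2.
apply: is_derive_eq; rewrite /GRing.scale/= sqr_sqrtr ?ltW//.
have x1 : 0 < x + 1 by rewrite addr_gt0.
have x1' : 0 < 1 + x by rewrite addr_gt0.
by move: (@pi R) p0 {h1 h2 h3} => q q0; field; rewrite !gt_eqF.
Qed.

Lemma continuous_phi_primitive : continuous phi_primitive.
Proof.
move=> x; apply: cvgMl_tmp; apply: (@continuous_comp _ _ _ (@Num.sqrt R) (@atan R)).
  exact: sqrt_continuous.
exact: continuous_atan.
Qed.

Lemma cvgy_phi_primitive : phi_primitive x @[x --> +oo] --> (1 : R).
Proof.
have -> : (1 : R) = 2 / pi * (pi / 2).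
  by rewrite mulrA divfK ?gt_eqF ?pi_gt0// mulfV.
apply: cvgMl_tmp; apply: cvg_comp (@cvgy_atan R).
apply/cvgryPge => A; near=> x.
have xA : A ^+ 2 <= x by near: x; apply: nbhs_pinfty_ge; rewrite num_real.
apply: le_trans (ler_norm A) _; rewrite -sqrtr_sqr ler_wsqrtr//.
Unshelve. all: by end_near. Qed.

Lemma continuous_phi_formula (x : R) : 0 < x ->
  {for x, continuous (fun x : R => (pi * (x + 1) * Num.sqrt x)^-1)}.
Proof.
move=> x0; have p0 := pi_gt0 R.
have s0 : 0 < Num.sqrt x by rewrite sqrtr_gt0.
apply: cvgV; first by rewrite gt_eqF// !mulr_gt0// addr_gt0.
apply: cvgM; last exact: sqrt_continuous.
by apply: cvgMl_tmp; apply: cvgD; [exact: cvg_id|exact: cvg_cst].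
Qed.

Lemma phi_measure_ray_lt0 (b : R) : b < 0 ->
  phi_measure `]-oo, b[%classic = (1 - angle b%:C / pi)%:E.
Proof.
move=> b0; pose s := - b; have s0 : 0 < s by rewrite oppr_gt0.
pose g (x : R) : R := (pi * (x + 1) * Num.sqrt x)^-1.
rewrite /phi_measure integral_itv_bndo_bndc; last first.
  by apply: measurable_funTS; apply/measurable_EFinP; exact: measurable_phi.
transitivity (\int[lambda]_(x in `]-oo, (- s)%R]) ((g \o -%R) x)%:E)%E.
  rewrite /s opprK; apply: eq_integral => x; rewrite inE/= in_itv/= => xb.
  by rewrite phi_lt0E// (le_lt_trans xb).
rewrite ge0_integration_by_substitutionNy; last 2 first.
- apply: continuous_in_subspaceT => x; rewrite inE/= in_itv/= => xs.
  apply: (@continuous_comp _ _ _ -%R g); first exact: opp_continuous.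
  by apply: continuous_phi_formula; rewrite oppr_gt0 (le_lt_trans xs)// oppr_lt0.
- move=> x; rewrite in_itv/= => xs.
  have x0 : 0 < - x by rewrite oppr_gt0 (lt_trans xs)// oppr_lt0.
  by rewrite /g/= invr_ge0 phi_den_ge0// ltW.
transitivity (\int[lambda]_(x in `[s%R, +oo[) (g x)%:E)%E.
  by apply: eq_integral => x _; rewrite /= opprK.
rewrite (ge0_continuous_FTC2y _ _ cvgy_phi_primitive).
- rewrite -EFinB /phi_primitive /angle /half_angle /s; congr (1 - _)%:E.
  by rewrite mulrAC.
- move=> x sx; have x0 := lt_le_trans s0 sx.
  by rewrite /g/= invr_ge0 phi_den_ge0// ltW.
- apply: continuous_in_subspaceT => x; rewrite inE/= in_itv/= andbT => sx.
  exact: continuous_phi_formula (lt_le_trans s0 sx).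
- move=> x sx; have := is_derive_phi_primitive (lt_trans s0 sx).
  by move=> h; exact: ex_derive.
- by apply: cvg_at_right_filter; exact: continuous_phi_primitive.
- move=> x; rewrite in_itv/= andbT => sx.
  have h := is_derive_phi_primitive (lt_trans s0 sx).
  by rewrite derive1E; exact: derive_val.
Qed.

Lemma angle0 : angle (0 : R)%:C = 0.
Proof. by rewrite /angle/= /half_angle oppr0 sqrtr0 atan0 mulr0. Qed.

(** The density is unbounded at 0, so the fundamental theorem of calculus is
    applied on the rays ending at [- 1 / (n + 1)], which increase to the whole
    negative half-line. *)
Lemma phi_measure_neg : phi_measure `]-oo, 0[%classic = 1%E.
Proof.
pose b (n : nat) : R := - n.+1%:R^-1.
have b0 n : b n < 0 by rewrite oppr_lt0 invr_gt0.
have cb : b n @[n --> \oo] --> (0 : R).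
  by rewrite -oppr0; apply: cvgN; exact: cvg_harmonic.
have bU : \bigcup_n `]-oo, b n[%classic = `]-oo, 0[%classic :> set R.
  apply/seteqP; split => [x [n _]|x]; rewrite /= !in_itv/=.
    by move=> /lt_trans; apply.
  move=> x0; have [N _ hN] := cvgr_gt 0 cb x x0.
  by exists N => //; rewrite /= in_itv/=; exact: hN (leqnn N).
have c1 : phi_measure `]-oo, b n[%classic @[n --> \oo] --> phi_measure `]-oo, 0[%classic.
  rewrite -bU; apply: nondecreasing_cvg_mu.
  - by move=> n; exact: measurable_itv.
  - by apply: bigcupT_measurable => n; exact: measurable_itv.
  - move=> m n mn; apply/subsetPset => x; rewrite /= !in_itv/= => /lt_le_trans; apply.
    by rewrite lerN2 lef_pV2 ?posrE// ler_nat ltnS.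
have c2 : phi_measure `]-oo, b n[%classic @[n --> \oo] --> 1%E.
  under eq_cvg do rewrite phi_measure_ray_lt0//.
  apply: cvg_EFin; first exact: nearW.
  rewrite -[X in _ --> X]subr0 -(mul0r pi^-1) -angle0.
  apply: cvgB; first exact: cvg_cst.
  apply: cvgMr_tmp.
  apply: (@cvg_comp _ _ _ b (fun x : R => angle x%:C) _ (nbhs (0 : R))) => //.
  apply: cvgMl_tmp; exact: continuous_half_angle.
by apply: (cvg_unique _ c1 c2).
Qed.

Lemma phi_measure_ray (b : R) : b <= 0 ->
  phi_measure `]-oo, b[%classic = (1 - angle b%:C / pi)%:E.
Proof.
rewrite le_eqVlt => /predU1P[->|]; last exact: phi_measure_ray_lt0.
by rewrite phi_measure_neg angle0 mul0r subr0.
Qed.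

Lemma phi_measure_ray_gt0 (b : R) : 0 < b -> phi_measure `]-oo, b[%classic = 1%E.
Proof.
move=> b0; rewrite -phi_measure_neg /phi_measure.
have mphi : measurable_fun setT (fun x : R => (phi x)%:E).
  by apply/measurable_EFinP; exact: measurable_phi.
have -> : `]-oo, b[%classic = `]-oo, 0[%classic `|` `[0, b[%classic :> set R.
  by rewrite -itv_bndbnd_setU// bnd_simp ltW.
rewrite ge0_integral_setU//.
- rewrite [X in (_ + X)%E](_ : _ = 0%E) ?adde0//.
  rewrite -(@integral0 _ _ _ lambda `[0, b[%classic); apply: eq_integral => x.
  by rewrite inE/= in_itv/= => /andP[x0 _]; rewrite phi_ge0E.
- exact: measurable_funTS.
- by move=> x _; rewrite lee_fin phi_ge0.
- apply/disj_set2P/seteqP; split => // x []; rewrite /= !in_itv/= => x0 /andP[].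
  by move=> /(lt_le_trans x0); rewrite ltxx.
Qed.

Lemma M1_Rminus_ray_gt0 mu (b : R) : M1_Rminus mu -> 0 < b ->
  distribution mu real_part `]-oo, b[%classic = 1%E.
Proof.
move=> hR b0; have mRm := measurable_embedC (@measurable_Rminus R).
apply/eqP; rewrite eq_le probability_le1//= -[leLHS]hR.
apply: le_measure; rewrite ?inE//.
  by rewrite -[X in measurable X]setTI; exact: measurable_real_part.
by move=> _ [x x0 <-]; rewrite /= in_itv/=; exact: le_lt_trans b0.
Qed.

(** Both measures give the mass [1 - angle b / pi] to the rays [x < b] with
    [b <= 0], and mass 1 to the other ones; rays form a generating pi-system. *)
Lemma minimizer_real_part_law mu (A : set R) : is_minimizer mu -> measurable A ->
  distribution mu real_part A = phi_measure A.
Proof.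
move=> hmu mA; have [hR _] := hmu.
apply: (measure_unique (@RGenInftyO.G R) (fun n => `]-oo, n%:R[%classic)) => //.
- exact: RGenInftyO.measurableE.
- move=> _ _ [a ->] [b ->]; exists (Num.min a b).
  apply/seteqP; split => x; rewrite /= !in_itv/= lt_min; first by move=> [-> ->].
  by move/andP.
- by move=> n; exists n%:R.
- apply/seteqP; split => // x _; exists (Num.truncn x).+1 => //.
  by rewrite /= in_itv/= truncnS_gt.
- move=> _ [b ->]; have [b0|b0] := leP b 0.
    by apply: etrans (minimizer_ray hmu b0) _; apply/esym/phi_measure_ray.
  by apply: etrans (M1_Rminus_ray_gt0 hR b0) _; apply/esym/phi_measure_ray_gt0.
- move=> n; apply: le_lt_trans (ltry 1); apply: probability_le1.
  exact: measurable_itv.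
Qed.

End Minimizer.

Theorem theorem1p3 (R : realType) (muR : M1 R) (hmuR : is_minimizer muR)
    (A : set R) (mA : measurable A) (hA : A `<=` @Rminus R) :
  muR (embedC A) = (\int[lebesgue_measure]_(x in A) (phi x)%:E)%E.
Proof.
rewrite -/(phi_measure A) -(minimizer_real_part_law hmuR mA).
have mRm := measurable_embedC (@measurable_Rminus R).
have mpre : measurable (@real_part R @^-1` A).
  by rewrite -[X in measurable X]setTI; exact: (@measurable_real_part R).
rewrite /distribution /pushforward -(probability_setI1 mpre mRm (proj1 hmuR)).
congr (muR _); apply/seteqP; split => z.
  by move=> [x Ax <-]; split => //; exists x => //; exact: hA.
by move=> [h [x _ xz]]; exists x => //; rewrite -xz in h.
Qed.
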